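(* Let $u_0$ and $u_1$ be two toric plurisubharmonic functions on the unit polydisk $\mathbb D^n$ with zero boundary values on $\partial\mathbb D^n$, and let $u_t$, $0<t<1$, be the geodesic of $u_0$ and $u_1$. Then the convex image $\check u_t$ of $u_t$ has the representation $$\check u_t=\mathcal L\left[(1-t)\,\mathcal L[\check u_0]+t\,\mathcal L[\check u_1]\right]\quad\text{on } \mathbb R^n_-,\qquad 0<t<1.$$
   Context: $\mathbb D^n\subset\mathbb C^n$ is the unit polydisk and $\mathbb R^n_-=\{s\in\mathbb R^n: s_j<0,\ 1\le j\le n\}$. A function $u$ on $\mathbb D^n$ is toric if $u(z)$ depends only on $|z_1|,\dots,|z_n|$. Zero boundary values means $u(z)\to 0$ as $z\to\partial\mathbb D^n$. Convex image: for a toric plurisubharmonic $u$ on $\mathbb D^n$, $\check u(s)=u(e^{s_1},\dots,e^{s_n})$ for $s\in\mathbb R^n_-$; this is a convex function on $\mathbb R^n_-$, increasing in each variable. For the purpose of taking Legendre transforms it is set equal to $+\infty$ on $\mathbb R^n\setminus\mathbb R^n_-$. Legendre transform: $\mathcal L[f](y)=\sup_{x\in\mathbb R^n}\{\langle x,y\rangle-f(x)\}$, for $f:\mathbb R^n\to(-\infty,+\infty]$. Geodesics: let $W(u_0,u_1)$ be the class of nonpositive plurisubharmonic functions $v(z,\zeta)$ on $\mathbb D^n\times\{\zeta\in\mathbb C:1<|\zeta|<e\}$ whose boundary values on $\mathbb D^n\times\{\log|\zeta|=j\}$ do not exceed $u_j$, i.e. $\limsup_{\log|\zeta|\to j}v(z,\zeta)\le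 u_j(z)$ for all $z\in\mathbb D^n$, $j=0,1$. A subgeodesic of $u_0$ and $u_1$ is a family of functions $v_t$, $0<t<1$, on $\mathbb D^n$ such that $v(z,\zeta):=v_{\log|\zeta|}(z)$ belongs to $W(u_0,u_1)$. The geodesic $u_t$ of $u_0$ and $u_1$ is their largest subgeodesic. *)

(* Defs.v *)
From HB Require Import structures.
From mathcomp Require Import all_boot all_order all_algebra.
From mathcomp Require Import complex.
From mathcomp Require Import all_classical all_reals all_analysis.

Set Implicit Arguments.
Unset Strict Implicit.
Unset Printing Implicit Defensive.

Import Order.TTheory GRing.Theory Num.Theory.
Import numFieldNormedType.Exports.

Local Open Scope classical_set_scope.
Local Open Scope ring_scope.
Local Open Scope ereal_scope.

(* R[i] packed as a numFieldType, so that the topology and the normed module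
   structures that the analysis library puts on every numFieldType are found;
   they are not inferred on the bare carrier R[i]. *)
Definition Cx (R : realType) : numFieldType := R[i].

(* The norm of Cx R takes values in Cx R; [cabs] is the same number in R. *)
Definition cabs (R : realType) (z : Cx R) : R := complex.Re `|z|%R.

Definition cis (R : realType) (theta : R) : Cx R :=
  (cos theta +i* sin theta)%C.

(** Subharmonic and plurisubharmonic functions.  Functions on a domain are
    total functions of which only the values on the domain matter; they may
    take the value -oo, and the function identically -oo is allowed. *)

Definition usc_on (R : realType) (T : topologicalType) (D : set T)
    (u : T -> \bar R) : Prop :=
  forall x, D x -> forall a : R, u x < a%:E ->
    \forall y \near within D (nbhs x), u y < a%:E.

(* For f upper semicontinuous and < +oo, the positive part of f is bounded on
   the circle, so the integral is well defined in [-oo, +oo[. *)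
Definition circle_mean (R : realType) (f : Cx R -> \bar R) (c : Cx R) (r : R)
    : \bar R :=
  ((2 * pi)^-1)%:E *
  \int[lebesgue_measure]_(theta in `[0%R, (2 * pi)%R])
    f (c + (r%:C)%C * cis theta)%R.

Definition subharmonic (R : realType) (D : set (Cx R)) (f : Cx R -> \bar R)
    : Prop :=
  [/\ forall x, D x -> f x < +oo,
      usc_on D f &
      forall (c : Cx R) (r : R), (0 < r)%R ->
        (forall x : Cx R, (cabs (x - c) <= r)%R -> D x) ->
        f c <= circle_mean f c r].

Definition plurisubharmonic (R : realType) (V : normedModType (Cx R))
    (D : set V) (u : V -> \bar R) : Prop :=
  [/\ forall x, D x -> u x < +oo,
      usc_on D u &
      forall a b : V,
        subharmonic [set tau : Cx R | D (a + tau *: b)%R]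
                    (fun tau => u (a + tau *: b)%R)].

(** The polydisk and toric functions *)

Definition polydisk (R : realType) (n : nat) : set 'rV[Cx R]_n :=
  [set z | forall j, (cabs (z ord0 j) < 1)%R].
Arguments polydisk R n : clear implicits.

Definition toric (R : realType) (n : nat) (u : 'rV[Cx R]_n -> \bar R) : Prop :=
  forall z w, polydisk R n z -> polydisk R n w ->
    (forall j, cabs (z ord0 j) = cabs (w ord0 j)) -> u z = u w.

Definition zero_boundary_values (R : realType) (n : nat)
    (u : 'rV[Cx R]_n -> \bar R) : Prop :=
  forall p, (closure (polydisk R n) `\` polydisk R n) p ->
    u z @[z --> within (polydisk R n) (nbhs p)] --> 0.

(** Convex images and the Legendre transform *)

Definition Rneg (R : realType) (n : nat) : set 'rV[R]_n :=
  [set s | forall j, (s ord0 j < 0)%R].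
Arguments Rneg R n : clear implicits.

Definition convex_image (R : realType) (n : nat) (u : 'rV[Cx R]_n -> \bar R)
    (s : 'rV[R]_n) : \bar R :=
  if s \in Rneg R n then u (\row_j ((expR (s ord0 j))%:C)%C)%R else +oo.

Definition dotp (R : realType) (n : nat) (x y : 'rV[R]_n) : R :=
  (\sum_(j < n) x ord0 j * y ord0 j)%R.

Definition legendre (R : realType) (n : nat) (f : 'rV[R]_n -> \bar R)
    (y : 'rV[R]_n) : \bar R :=
  ereal_sup [set (dotp x y)%:E - f x | x in [set: 'rV[R]_n]].

(** Geodesics *)

Definition annulus (R : realType) : set (Cx R) :=
  [set zeta | (1 < cabs zeta < expR 1)%R].
Arguments annulus R : clear implicits.

Definition log_cabs_to (R : realType) (c : R) : set_system (Cx R) :=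
  filter_from [set e : R | (0 < e)%R]
    (fun e => [set zeta | annulus R zeta /\ (`|ln (cabs zeta) - c| < e)%R]).

Definition geodesic_class (R : realType) (n : nat)
    (u0 u1 : 'rV[Cx R]_n -> \bar R)
    (v : 'rV[Cx R]_n * Cx R -> \bar R) : Prop :=
  [/\ plurisubharmonic (polydisk R n `*` annulus R) v,
      forall p, (polydisk R n `*` annulus R) p -> v p <= 0,
      forall z, polydisk R n z ->
        limf_esup (fun zeta => v (z, zeta)) (log_cabs_to 0) <= u0 z &
      forall z, polydisk R n z ->
        limf_esup (fun zeta => v (z, zeta)) (log_cabs_to 1) <= u1 z].

Definition subgeodesic (R : realType) (n : nat)
    (u0 u1 : 'rV[Cx R]_n -> \bar R) (v : R -> 'rV[Cx R]_n -> \bar R) : Prop :=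
  geodesic_class u0 u1 (fun p => v (ln (cabs p.2)) p.1).

Definition geodesic (R : realType) (n : nat)
    (u0 u1 : 'rV[Cx R]_n -> \bar R) (u : R -> 'rV[Cx R]_n -> \bar R) : Prop :=
  subgeodesic u0 u1 u /\
  forall v, subgeodesic u0 u1 v ->
    forall t z, (0 < t < 1)%R -> polydisk R n z -> v t z <= u t z.

(* Main.v *)
(** A toric plurisubharmonic function is convex in the variables [ln |z_j|]: its
    mean-value inequality on the complex line through [z] in the direction
    [(d_j z_j)] reads [phi s <= mean (phi (s + L))], where the [j]-th component of
    [L] is [ln |1 + d_j e^(i theta)|], which has mean zero and is
    [d_j cos theta + O(d_j^2)].  The geodesic is itself toric, by maximality, so
    [U (s, t) = u_t (e^s)] is jointly convex.

    Upper bound: joint convexity and the boundary conditions give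
    [U ((1 - t) s0 + t s1, t) <= (1 - t) u0 (e^s0) + t u1 (e^s1)], and a supporting
    hyperplane of [U (-, t)] at [s] turns this into the inequality for the
    Legendre transforms.

    Lower bound: whenever [A = L[u0](y)] and [B = L[u1](y)] are finite, one has
    [y >= 0] (by semicontinuity where some [z_j = 0]) and [A, B >= 0] (by the
    boundary values), and [sum_j y_j ln |z_j| - ((1 - ln |zeta|) A + ln |zeta| B)]
    is a subgeodesic, so it lies below the geodesic. *)
Require Import Defs.
From HB Require Import structures.
From mathcomp Require Import all_boot all_order all_algebra.
From mathcomp Require Import complex.
From mathcomp Require Import all_classical all_reals all_analysis.
From mathcomp Require Import ring lra.
Set Implicit Arguments.
Unset Strict Implicit.
Unset Printing Implicit Defensive.
Import Order.TTheory GRing.Theory Num.Theory.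
Import numFieldNormedType.Exports.
Local Open Scope classical_set_scope.
Local Open Scope ring_scope.

(** * Mean values over circles *)

(** The mean-value inequality does not compare two-point averages: the curve [s + L] is not a
    segment, and [U] is merely upper semicontinuous and may be -oo, so it has no second derivative
    to work with. Two features of [L] make up for this. Its mean is exactly zero, so linear terms
    cancel without error; and its excursion transverse to [d] is quadratic in the radius, so it
    enters a quadratic barrier only at fourth order. A barrier strictly concave along the segment
    therefore wins at second order.

    Because of the value -oo, convexity and support are phrased through real strict upper bounds of
    the values involved. The ends t = 0 and t = 1 are known only through upper limits, so the
    segments used stop short of them.

    In the lower bound the coefficient [A - B] of ln |zeta| has either sign, so this term needs an
    exact mean value, which holds because the annulus avoids 0. The terms [y_j ln |z_j|] have poles
    inside the polydisk and need only a submean inequality, which decreasing continuous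
    regularisations provide. *)

Lemma continuous_antiderivative (R : realType) (h : R -> R) :
  continuous h ->
  exists G : R -> R, forall x : R, -1 < x -> is_derive x 1 G (h x).
Proof.
move=> ch.
(* Starting the integral at -1 makes 0 an interior point, so the derivative is two-sided on all of
   [0, 2 pi]. *)
exists (fun y : R => \int[lebesgue_measure]_(t in [set` `[-1, y]]) h t) => x x1.
have ih : lebesgue_measure.-integrable `[-1, x + 1] (EFin \o h).
  apply: continuous_compact_integrable; first exact: segment_compact.
  exact: continuous_subspaceT.
have xx1 : x < x + 1 by rewrite ltrDl.
have [dG GE] := continuous_FTC1_closed xx1 ih x1 (ch x).
by apply: DeriveDef => //; rewrite -derive1E.
Qed.

Lemma integral_antiderivative (R : realType) (h G : R -> R) (a b : R) :
  continuous h -> a < b ->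
  (forall x : R, a <= x <= b -> is_derive x 1 G (h x)) ->
  (\int[lebesgue_measure]_(x in `[a, b]) (h x)%:E = (G b - G a)%:E)%E.
Proof.
move=> ch ab dG.
have cG x : a <= x <= b -> {for x, continuous G}.
  move=> /dG [dGx _].
  by apply/differentiable_continuous/derivable1_diffP.
rewrite EFinB; apply: continuous_FTC2 => //.
- exact: continuous_subspaceT.
- split.
  + move=> x; rewrite in_itv/= => /andP[ax xb].
    by have [] := dG x _; rewrite ?(ltW ax) ?(ltW xb).
  + by apply: cvg_at_right_filter; apply: cG; rewrite lexx ltW.
  + by apply: cvg_at_left_filter; apply: cG; rewrite lexx ltW.
- move=> x; rewrite in_itv/= => /andP[ax xb].
  have [|dx <-] := dG x _; first by rewrite !ltW.
  by rewrite derive1E.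
Qed.

(** Real-valued companion of [circle_mean] for continuous functions, where linearity and
    monotonicity hold without conventions about infinite values. *)
Definition cmean (R : realType) (h : R -> R) : R :=
  (2 * pi)^-1 * \int[lebesgue_measure]_(x in `[0, 2 * pi]) h x.

Lemma continuous_sumr (R : numFieldType) (T : topologicalType) (I : Type) (r : seq I)
    (F : I -> T -> R) :
  (forall i, continuous (F i)) -> continuous (fun x => \sum_(i <- r) F i x).
Proof.
move=> cF x; elim: r => [|i r IH]; rewrite /continuous_at.
  by rewrite big_nil; under eq_fun do rewrite big_nil; exact: cvg_cst.
rewrite big_cons; under eq_fun do rewrite big_cons.
by apply: cvgD => //; exact: cF.
Qed.

Section Cmean.
Context {R : realType}.
Implicit Types h f g : R -> R.

Let twopi_gt0 : 0 < 2 * pi :> R.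
Proof. by rewrite mulr_gt0 ?pi_gt0. Qed.

Lemma circle_integrable h : continuous h ->
  lebesgue_measure.-integrable `[0, 2 * pi] (EFin \o h).
Proof.
move=> ch; apply: continuous_compact_integrable; first exact: segment_compact.
exact: continuous_subspaceT.
Qed.

Lemma cmeanE h G : continuous h ->
  (forall x : R, 0 <= x <= 2 * pi -> is_derive x 1 G (h x)) ->
  cmean h = (2 * pi)^-1 * (G (2 * pi) - G 0).
Proof.
by move=> ch dG; rewrite /cmean /Rintegral (integral_antiderivative _ _ dG).
Qed.

Lemma cmeanD f g : continuous f -> continuous g ->
  cmean (fun x => f x + g x) = cmean f + cmean g.
Proof.
move=> cf cg; rewrite /cmean RintegralD; first exact: mulrDr.
- exact: measurable_itv.
- exact: circle_integrable.
- exact: circle_integrable.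
Qed.

Lemma cmeanZ (k : R) f : continuous f ->
  cmean (fun x => k * f x) = k * cmean f.
Proof.
move=> cf; rewrite /cmean RintegralZl; first exact: mulrCA.
- exact: measurable_itv.
- exact: circle_integrable.
Qed.

Lemma cmeanB f g : continuous f -> continuous g ->
  cmean (fun x => f x - g x) = cmean f - cmean g.
Proof.
move=> cf cg; rewrite -mulN1r -cmeanZ// -cmeanD//.
  by congr cmean; apply/funext => x; rewrite mulN1r.
by move=> x; apply: cvgM; [exact: cvg_cst|exact: cg].
Qed.

Lemma cmean_cst (k : R) : cmean (fun=> k) = k.
Proof.
have ck : continuous (fun _ : R => k) by move=> x; exact: cvg_cst.
have dk (x : R) : 0 <= x <= 2 * pi -> is_derive x 1 (fun x => k * x) k.
  by move=> _; rewrite -{2}[k]mulr1; exact: (is_deriveZ k (is_derive_id x (1 : R))).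
by rewrite (cmeanE ck dk) mulr0 subr0 mulrCA mulVf ?mulr1 ?gt_eqF.
Qed.

Lemma cmean_le f g : continuous f -> continuous g ->
  (forall x, f x <= g x) -> cmean f <= cmean g.
Proof.
move=> cf cg fg; rewrite /cmean ler_pM2l ?invr_gt0//.
apply: le_Rintegral; first exact: measurable_itv.
- exact: circle_integrable.
- exact: circle_integrable.
- by move=> x _.
Qed.

Lemma cmean_sum (I : Type) (r : seq I) (F : I -> R -> R) :
  (forall i, continuous (F i)) ->
  cmean (fun x => \sum_(i <- r) F i x) = \sum_(i <- r) cmean (F i).
Proof.
move=> cF; elim: r => [|i r IH].
  by rewrite big_nil; under eq_fun do rewrite big_nil; rewrite cmean_cst.
rewrite big_cons -IH -cmeanD//; last exact: continuous_sumr.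
by congr cmean; apply/funext => x; rewrite big_cons.
Qed.

(** An antiderivative of a periodic function grows by the same amount over every period, whatever
    the starting point. The cases k = 1 (a rotation) and k = 2 (winding twice) are those of the
    doubling identity for ln |1 + w e^(i x)|. *)
Lemma cmean_periodic h (k : nat) (c : R) :
  continuous h -> (forall x, h (x + 2 * pi) = h x) ->
  0 <= c -> (0 < k <= 2)%N -> cmean (fun x => h (k%:R * x + c)) = cmean h.
Proof.
move=> ch hp c0 k12; have [G dG] := continuous_antiderivative ch.
have Gp (x : R) : 0 <= x -> G (x + 2 * pi) - G x = G (2 * pi) - G 0.
  rewrite le_eqVlt => /predU1P[<-|x0]; first by rewrite add0r.
  have dH y : 0 <= y <= x ->
      is_derive y 1 (fun y => G (y + 2 * pi) - G y) 0.
    move=> /andP[y0 _].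
    have -> : 0 = h (y + 2 * pi) * 1 - h y :> R by rewrite hp mulr1 subrr.
    apply: is_deriveB; last by apply: dG; lra.
    apply: (@is_derive1_comp R G (fun y => y + 2 * pi)).
      by apply: dG; have := twopi_gt0; lra.
    rewrite -[X in is_derive _ _ _ X]addr0.
    exact: (is_deriveD (is_derive_id y (1 : R)) (is_derive_cst (2 * pi : R) y (1 : R))).
  have := @integral_antiderivative R (fun=> 0)
            (fun y => G (y + 2 * pi) - G y) 0 x _ x0 dH.
  rewrite add0r integral0 => /(_ (fun y => @cvg_cst R _ _ _ _)) /eqP.
  by rewrite eqe eq_sym subr_eq0 => /eqP.
have k0 : (0 : R) < k%:R by rewrite ltr0n; case/andP: k12.
have dGk (x : R) : 0 <= x <= 2 * pi ->
    is_derive x 1 (fun x => k%:R^-1 * G (k%:R * x + c)) (h (k%:R * x + c)).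
  move=> /andP[x0 _].
  have -> : h (k%:R * x + c) = k%:R^-1 * (h (k%:R * x + c) * k%:R).
    by rewrite mulrCA mulVf ?mulr1// gt_eqF.
  apply: is_deriveZ.
  apply: (@is_derive1_comp R G (fun x => k%:R * x + c)).
    by apply: dG; apply: (@lt_le_trans _ _ 0); rewrite ?ltrN10 ?addr_ge0 ?mulr_ge0.
  rewrite -[X in is_derive _ _ _ X]addr0 -[X in X + 0]mulr1.
  exact: (is_deriveD (is_deriveZ k%:R (is_derive_id x (1 : R)))
                     (is_derive_cst (c : R) x (1 : R))).
have chk : continuous (fun x : R => h (k%:R * x + c)).
  move=> x; apply: continuous_comp; last exact: ch.
  apply: cvgD; last exact: cvg_cst.
  by apply: cvgM; [exact: cvg_cst|exact: cvg_id].
have dG0 (x : R) : 0 <= x <= 2 * pi -> is_derive x 1 G (h x).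
  by move=> /andP[x0 _]; apply: dG; lra.
rewrite (cmeanE chk dGk) (cmeanE ch dG0).
rewrite mulr0 add0r; congr (_ * _).
have G2 := Gp c c0; have G4 := Gp (c + 2 * pi) (ltac:(by rewrite addr_ge0// ltW)).
case: k k12 {k0 dGk chk} => [//|[|[|//]]] _.
  by rewrite invr1 !mul1r [2 * pi + c]addrC.
rewrite -mulrBr.
have -> : 2 * (2 * pi) + c = c + 2 * pi + 2 * pi :> R by ring.
by lra.
Qed.

End Cmean.

(** * Modulus and topology of the complex plane *)

Section Cabs.
Context {R : realType}.
Implicit Types (z w : Cx R) (x y : R).

Lemma cabsE z : cabs z = Num.sqrt (complex.Re z ^+ 2 + complex.Im z ^+ 2).
Proof. by case: z. Qed.

Lemma normCx z : `|z| = ((cabs z)%:C)%C.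
Proof. by case: z. Qed.

Lemma cabs_sqr z : cabs z ^+ 2 = complex.Re z ^+ 2 + complex.Im z ^+ 2.
Proof. by rewrite cabsE sqr_sqrtr// addr_ge0// sqr_ge0. Qed.

Lemma cabs_ge0 z : 0 <= cabs z.
Proof. by rewrite cabsE sqrtr_ge0. Qed.

Lemma cabsM z w : cabs (z * w) = cabs z * cabs w.
Proof. by apply: complexI; rewrite rmorphM -!normCx normrM. Qed.

Lemma cabsD z w : cabs (z + w) <= cabs z + cabs w.
Proof. by rewrite -lecR rmorphD -!normCx ler_normD. Qed.

Lemma cabsN z : cabs (- z) = cabs z.
Proof. by apply: complexI; rewrite -!normCx normrN. Qed.

Lemma cabsB z w : cabs (z - w) = cabs (w - z).
Proof. by rewrite -cabsN opprB. Qed.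

Lemma cabs_eq0 z : (cabs z == 0) = (z == 0).
Proof.
rewrite -[RHS]normr_eq0 normCx; apply/eqP/eqP => [->//|].
by move=> /(congr1 (@complex.Re R)).
Qed.

Lemma cabs0 : cabs (0 : Cx R) = 0.
Proof. by apply/eqP; rewrite cabs_eq0. Qed.

Lemma cabsR x : cabs (x%:C)%C = `|x|.
Proof. by rewrite cabsE/= expr0n addr0 sqrtr_sqr. Qed.

Lemma cabs1 : cabs (1 : Cx R) = 1.
Proof. by rewrite (_ : 1 = (1%:C)%C)// cabsR normr1. Qed.

Lemma cabsV z : cabs (z^-1) = (cabs z)^-1.
Proof. by apply: complexI; rewrite fmorphV -!normCx normfV. Qed.

Lemma cabs_cis x : cabs (cis x) = 1.
Proof. by rewrite cabsE/= cos2Dsin2 sqrtr1. Qed.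

Lemma cabs_gt0 z : (0 < cabs z) = (z != 0).
Proof. by rewrite lt_def cabs_ge0 andbT cabs_eq0. Qed.

Lemma ler_dist_cabs z w : `|cabs z - cabs w| <= cabs (z - w).
Proof.
have := cabsD (z - w) w; have := cabsD (w - z) z; rewrite !subrK cabsB => h1 h2.
by rewrite ler_norml; apply/andP; split; lra.
Qed.

(** The balls of [Cx R] have radii in [Cx R] itself; positivity there forces the imaginary part to
    vanish, so real radii suffice. *)
Lemma nbhs_CxP z (P : set (Cx R)) :
  nbhs z P <-> exists2 e : R, 0 < e & forall w, cabs (z - w) < e -> P w.
Proof.
split=> [/nbhs_ballP[e /= e0 eP]|[e e0 eP]]; last apply/nbhs_ballP.
- have /eqP eI : complex.Im e == 0 by move: e0; rewrite ltcE => /andP[].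
  exists (complex.Re e); first by move: e0; rewrite ltcE => /andP[].
  move=> w zw; apply: eP; rewrite /ball/= normCx.
  by rewrite ltcE /= eI eqxx.
- exists (e%:C)%C; first by rewrite /= ltcR.
  by move=> w; rewrite /ball/= normCx ltcR => /eP.
Qed.

Lemma continuous_cabs : continuous (@cabs R).
Proof.
move=> z P /nbhs_ballP[e /= e0 eP]; apply/nbhs_CxP; exists e => // w zw.
by apply: eP; apply: le_lt_trans zw; exact: ler_dist_cabs.
Qed.

Lemma continuous_cis : continuous (@cis R).
Proof.
move=> x P /nbhs_CxP[e e0 eP].
have e20 : 0 < e / 2 by rewrite divr_gt0.
have /cvgrPdist_lt/(_ _ e20) cc := @continuous_cos R x.
have /cvgrPdist_lt/(_ _ e20) ss := @continuous_sin R x.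
have : \forall y \near x, `|cos x - cos y| < e / 2 /\ `|sin x - sin y| < e / 2.
  by apply: filterI.
apply: (@filterS _ (nbhs x)) => y [cxy sxy]; apply: eP.
have -> : cis x - cis y = ((cos x - cos y)%:C)%C + 'i%C * ((sin x - sin y)%:C)%C :> Cx R.
  by rewrite [LHS]complexE.
apply: (le_lt_trans (cabsD _ _)); rewrite cabsM !cabsR.
have -> : cabs ('i%C : Cx R) = 1 by rewrite cabsE/= expr0n add0r expr1n sqrtr1.
by rewrite mul1r [e]splitr ltrD.
Qed.

Lemma cisD x y : cis (x + y) = cis x * cis y :> Cx R.
Proof.
apply/eqP; rewrite eq_complex; apply/andP; split; apply/eqP => /=.
  by rewrite cosD.
by rewrite sinD addrC.
Qed.

Lemma cis_pi : cis pi = -1 :> Cx R.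
Proof. by rewrite /cis cospi sinpi; apply/eqP; rewrite eq_complex/= oppr0 !eqxx. Qed.

Lemma cis_2pi x : cis (x + 2 * pi) = cis x :> Cx R.
Proof.
have -> : x + 2 * pi = x + pi + pi by ring.
by rewrite (cisD (x + pi)) (cisD x) cis_pi !mulrN1 opprK.
Qed.

End Cabs.

(** * Mean of ln |a + b e^(i x)| over the circle *)

Section MeanLn.
Context {R : realType}.
Implicit Types (z w a b : Cx R) (x y : R).

Lemma continuous_circle a b : continuous (fun x => a + b * cis x).
Proof.
move=> x; apply: cvgD; first exact: cvg_cst.
by apply: cvgM; [exact: cvg_cst|exact: continuous_cis].
Qed.

Lemma circle_neq0 a b x : cabs b < cabs a -> a + b * cis x != 0.
Proof.
move=> ba; apply: contraTneq ba => /eqP; rewrite addr_eq0 => /eqP ->.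
by rewrite cabsN cabsM cabs_cis mulr1 ltxx.
Qed.

Lemma continuous_ln_comp (f : R -> R) :
  continuous f -> (forall x, 0 < f x) -> continuous (fun x => ln (f x)).
Proof.
move=> cf f0 x; apply: (continuous_comp (cf x)).
exact: continuous_ln.
Qed.

Lemma continuous_ln_circle a b : cabs b < cabs a ->
  continuous (fun x => ln (cabs (a + b * cis x))).
Proof.
move=> ba; apply: continuous_ln_comp => x.
  apply: (@continuous_comp _ _ _ (fun x => a + b * cis x) (@cabs R)).
    exact: continuous_circle.
  exact: continuous_cabs.
by rewrite cabs_gt0 circle_neq0.
Qed.

(* The mean m(w) of [ln |1 + w e^(i x)|] satisfies 2 m(w) = m(w^2), since
   (1 + w e^(i x)) (1 + w e^(i (x + pi))) = 1 + w^2 e^(i (2 x + pi)). *)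
Lemma cmean_ln_doubling w : cabs w < 1 ->
  cmean (fun x => ln (cabs (1 + w * cis x))) * 2 =
  cmean (fun x => ln (cabs (1 + w ^+ 2 * cis x))).
Proof.
move=> w1; have w1' : cabs w < cabs (1 : Cx R) by rewrite cabs1.
have ww1 : cabs (w ^+ 2) < cabs (1 : Cx R).
  rewrite cabs1 expr2 cabsM -[ltRHS](mul1r 1).
  by rewrite ltr_pM// cabs_ge0.
have c1 := continuous_ln_circle w1'; have c2 := continuous_ln_circle ww1.
have per v x : ln (cabs (1 + v * cis (x + 2 * pi))) = ln (cabs (1 + v * cis x)).
  by rewrite cis_2pi.
rewrite -(cmean_periodic (k := 2) (c := pi) c2 (per _)) ?pi_ge0//.
rewrite mulr_natr mulr2n.
rewrite -{2}(cmean_periodic (k := 1) (c := pi) c1 (per _)) ?pi_ge0//.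
rewrite -cmeanD//; last first.
  move=> x; apply: (@continuous_comp _ _ _ (fun x : R => 1 * x + pi)
    (fun x => ln (cabs (1 + w * cis x)))); last exact: c1.
  by apply: cvgD; [apply: cvgM; [exact: cvg_cst|exact: cvg_id]|exact: cvg_cst].
congr cmean; apply/funext => x.
rewrite -lnM ?posrE ?cabs_gt0 ?circle_neq0// -cabsM; congr (ln (cabs _)).
rewrite mul1r (mulr_natl x 2) mulr2n (cisD x pi) (cisD (x + x)) (cisD x x) cis_pi.
by ring.
Qed.

(** Any bound uniform in [w] would do: it is divided by 2^k when the doubling identity is
    iterated. *)
Lemma ln_cabs_bound w x : cabs w <= 2^-1 -> `|ln (cabs (1 + w * cis x))| <= 2.
Proof.
move=> w2.
have u1 : cabs (1 + w * cis x) <= 2.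
  by apply: (le_trans (cabsD _ _)); rewrite cabs1 cabsM cabs_cis; lra.
have l1 : 2^-1 <= cabs (1 + w * cis x).
  have := cabsD (1 + w * cis x) (- (w * cis x)).
  by rewrite addrK cabs1 cabsN cabsM cabs_cis; lra.
have p0 : 0 < cabs (1 + w * cis x) by lra.
rewrite ler_norml; apply/andP; split; last first.
  have := @le_ln1Dx R (cabs (1 + w * cis x) - 1).
  by rewrite [1 + (_ - 1)]addrC subrK; lra.
rewrite lerNl -lnV ?posrE//.
have v2 : (cabs (1 + w * cis x))^-1 <= 2.
  by rewrite -[leRHS]invrK lef_pV2 ?posrE// invr_gt0.
have := @le_ln1Dx R ((cabs (1 + w * cis x))^-1 - 1).
have : 0 < (cabs (1 + w * cis x))^-1 by rewrite invr_gt0.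
by rewrite [1 + (_ - 1)]addrC subrK; lra.
Qed.

(** Iterated doubling gives 2^k m(w) = m(w^(2^k)). The right side is at most 2 in absolute value
    once |w^(2^k)| <= 1/2, so m(w) must be 0. *)
Lemma cmean_ln_small w : cabs w < 1 ->
  cmean (fun x => ln (cabs (1 + w * cis x))) = 0.
Proof.
move=> w1.
have pw1 k : cabs (w ^+ (2 ^ k)) < 1.
  elim: k => [|k IH]; first by rewrite expr1.
  rewrite expnS mulnC exprM expr2 cabsM -[ltRHS](mul1r 1).
  by rewrite ltr_pM// cabs_ge0.
pose m k := cmean (fun x => ln (cabs (1 + w ^+ (2 ^ k) * cis x))).
have mE k : m 0%N * 2 ^+ k = m k.
  elim: k => [|k IH]; first by rewrite mulr1.
  rewrite exprSr mulrA IH /m cmean_ln_doubling// -exprM.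
  by rewrite expnSr.
have cabsX k : cabs (w ^+ k) = cabs w ^+ k.
  by elim: k => [|k IH]; rewrite ?cabs1// !exprS cabsM IH.
have [N w2] : exists N, forall k, (N <= k)%N -> cabs (w ^+ (2 ^ k)) <= 2^-1.
  have /cvgrPdist_lt/(_ 2^-1)[//|N _ NP] : (cabs w ^+ k @[k --> \oo] --> 0).
    by apply: cvg_expr; rewrite ger0_norm ?cabs_ge0.
  exists N => k Nk; rewrite cabsX.
  have /NP : (N <= 2 ^ k)%N by rewrite (leq_trans Nk)// ltnW// ltn_expl.
  by rewrite /= sub0r normrN => /ltW; apply: le_trans; exact: ler_norm.
have mb k : (N <= k)%N -> `|m k| <= 2.
  move=> /w2 wk.
  have cm : continuous (fun x => ln (cabs (1 + w ^+ (2 ^ k) * cis x))).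
    by apply: continuous_ln_circle; rewrite cabs1.
  have lb x : -2 <= ln (cabs (1 + w ^+ (2 ^ k) * cis x)) <= 2.
    by rewrite -ler_norml ln_cabs_bound.
  have c2 (c : R) : continuous (fun _ : R => c) by move=> x; exact: cvg_cst.
  rewrite ler_norml -{1}(cmean_cst (-2)) -{2}(cmean_cst 2).
  by apply/andP; split; apply: cmean_le => // x; case/andP: (lb x).
have -> : cmean (fun x => ln (cabs (1 + w * cis x))) = m 0%N.
  by rewrite /m expn0 expr1.
apply/eqP; apply: contraT => m0.
have [k km] : exists k, 2 / `|m 0%N| < (2 ^ k)%:R.
  have m0p : 0 < 2 / `|m 0%N| by rewrite divr_gt0// normr_gt0.
  exists (Num.truncn (2 / `|m 0%N|)).+1.
  have /andP[_ h] := truncn_itv (ltW m0p).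
  by apply: (lt_trans h); rewrite ltr_nat ltn_expl.
have := mb (maxn N k) (leq_maxl _ _).
rewrite -mE normrM [`|2 ^+ _|]ger0_norm ?exprn_ge0//.
rewrite leNgt => /negP[].
rewrite ltr_pdivrMr ?normr_gt0// in km.
apply: (lt_le_trans km); rewrite mulrC ler_pM2l ?normr_gt0//.
by rewrite natrX ler_eXn2l ?leq_maxr// ltr1n.
Qed.

Lemma cmean_ln_circle a b : cabs b < cabs a ->
  cmean (fun x => ln (cabs (a + b * cis x))) = ln (cabs a).
Proof.
move=> ba; have a0 : a != 0 by rewrite -cabs_gt0 (le_lt_trans _ ba)// cabs_ge0.
have ba1 : cabs (b / a) < 1.
  by rewrite cabsM cabsV ltr_pdivrMr ?cabs_gt0// mul1r.
have ba1' : cabs (b / a) < cabs (1 : Cx R) by rewrite cabs1.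
transitivity (cmean (fun x => ln (cabs a) + ln (cabs (1 + b / a * cis x)))).
  congr cmean; apply/funext => x.
  rewrite -lnM ?posrE ?cabs_gt0 ?circle_neq0// -cabsM; congr (ln (cabs _)).
  by rewrite mulrDr mulr1 mulrA [a * _]mulrC divfK.
rewrite cmeanD ?cmean_cst ?cmean_ln_small ?addr0//.
  by move=> x; exact: cvg_cst.
exact: continuous_ln_circle.
Qed.

End MeanLn.

(** * Extended-real circle means compared with real ones *)

Section CircleMean.
Local Open Scope ereal_scope.

(* No measurability is required: the integral of a nonnegative function is
   defined as a supremum over simple functions. *)
Lemma le_integral_nomeas d (T : measurableType d) (R : realType)
    (mu : {measure set T -> \bar R}) (D : set T) (f g : T -> \bar R) :
  (forall x, D x -> f x <= g x) ->
  \int[mu]_(x in D) f x <= \int[mu]_(x in D) g x.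
Proof.
move=> fg.
have fgD x : (f \_ D) x <= (g \_ D) x.
  by rewrite /patch; case: ifPn => // /set_mem/fg.
rewrite /integral; apply: leeB; apply: le_ereal_sup => _ [h /= hf <-];
  exists h => // x; apply: (le_trans (hf x)).
- by apply: (@funepos_le _ _ setT) => //; rewrite inE.
- by apply: (@funeneg_le _ _ setT) => //; rewrite inE.
Qed.

Lemma circle_mean_le (R : realType) (f : Cx R -> \bar R) (c : Cx R) (r : R) (h : R -> R) :
  continuous h -> (forall x, f (c + (r%:C)%C * cis x)%R <= (h x)%:E) ->
  circle_mean f c r <= (cmean h)%:E.
Proof.
move=> ch fh.
rewrite /cmean /Rintegral EFinM fineK; last first.
  apply: integrable_fin_num; first exact: measurable_itv.
  exact: circle_integrable.
rewrite /circle_mean; apply: lee_wpmul2l.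
  by rewrite lee_fin invr_ge0 mulr_ge0// pi_ge0.
by apply: le_integral_nomeas => x _; exact: fh.
Qed.

(* Monotone convergence for the decreasing sequence [h k]; the infimum may be -oo. *)
Lemma circle_mean_inf (R : realType) (f : Cx R -> \bar R) (c : Cx R) (r : R)
    (h : nat -> R -> R) (a : R) :
  (forall k, continuous (h k)) ->
  (forall k x, h k.+1 x <= h k x)%R ->
  (forall k, a <= cmean (h k))%R ->
  (forall x, f (c + (r%:C)%C * cis x)%R = ereal_inf [set (h k x)%:E | k in [set: nat]]) ->
  a%:E <= circle_mean f c r.
Proof.
move=> ch dh ah fh.
have mD : measurable (`[0%R, (2 * pi)%R]%classic : set (measurableTypeR R)).
  exact: measurable_itv.
have dhn n m x : (n <= m)%N -> (h m x <= h n x)%R.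
  move=> nm; apply: (homo_leq (r := fun u v : R => (v <= u)%R) (f := h^~ x)) nm => //.
  by move=> ? ? ? /[swap]; exact: le_trans.
(* Subtracting from the first member turns the decreasing sequence into an increasing nonnegative
   one. *)
pose g k x : \bar R := (h 0%N x - h k x)%:E.
have cg k : continuous (fun x => h 0%N x - h k x)%R.
  by move=> x; apply: cvgB; exact: ch.
have mg k := measurable_int _ (circle_integrable (cg k)).
have g0 k x : 0 <= g k x by rewrite lee_fin subr_ge0 dhn.
have ndg x : {homo g^~ x : n m / (n <= m)%N >-> n <= m}.
  by move=> n m nm; rewrite lee_fin lerB// dhn.
have limg x : limn (g^~ x) = (h 0%N x)%:E - f (c + (r%:C)%C * cis x)%R.
  have /cvg_lim -> // := ereal_nondecreasing_cvgn (ndg x).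
  rewrite fh; apply/eqP; rewrite eq_le; apply/andP; split.
    apply: ge_ereal_sup => _ [k _ <-]; rewrite /g EFinB leeB//.
    by apply: ereal_inf_lbound; exists k.
  rewrite -leeBrDl//; apply: le_trans (_ : - ereal_inf [set (h k x)%:E | k in [set: nat]] <= _).
    by [].
  rewrite leeNl; apply: le_ereal_inf_tmp => _ [k _ <-].
  rewrite leeNl; apply: le_trans (_ : g k x - (h 0%N x)%:E <= _).
    by rewrite /g -EFinB -EFinN lee_fin; lra.
  by apply: leeB => //; apply: ereal_sup_ubound; exists k.
have MC := monotone_convergence lebesgue_measure mD mg (fun n x _ => g0 n x) (fun x _ => ndg x).
have I0 := circle_integrable (ch 0%N).
have F0 := integrable_fin_num mD I0.
have p2 : (0 < 2 * pi :> R)%R by rewrite mulr_gt0 ?pi_gt0.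
pose G x := limn (g^~ x).
have Ig k : \int[lebesgue_measure]_(x in `[0%R, (2 * pi)%R]) g k x =
   ((2 * pi) * (cmean (h 0%N) - cmean (h k)))%:E.
  rewrite -cmeanB//.
  rewrite /cmean mulrA mulfV ?gt_eqF// mul1r /Rintegral fineK//.
  exact: (integrable_fin_num mD (circle_integrable (cg k))).
(* The lower bound [a] on the means makes the limit [G] integrable, which allows the integral of
   [h 0 - G] to be split. *)
have IG : \int[lebesgue_measure]_(x in `[0%R, (2 * pi)%R]) G x <=
   ((2 * pi) * (cmean (h 0%N) - a))%:E.
  rewrite MC; apply: lime_le.
    apply: ereal_nondecreasing_is_cvgn => n m nm.
    by apply: le_integral_nomeas => x _; exact: ndg.
  by near=> N; rewrite Ig lee_fin ler_pM2l// lerB.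
have G0 x : 0 <= G x.
  by apply: lime_ge; [exact: ereal_nondecreasing_is_cvgn|near=> N].
have mG := measurable_realfun.emeasurable_fun_cvg g G mg
  (fun x _ => ereal_nondecreasing_is_cvgn (ndg x)).
have iG : lebesgue_measure.-integrable `[0%R, (2 * pi)%R] G.
  apply/integrableP; split=> //.
  under eq_integral do rewrite gee0_abs//.
  by apply: (le_lt_trans IG); rewrite ltry.
have fE x : f (c + (r%:C)%C * cis x)%R = (h 0%N x)%:E - G x.
  by rewrite /G limg oppeB ?fin_num_adde_defr// addeA -EFinB subrr add0e.
rewrite /circle_mean.
under eq_integral do rewrite fE.
rewrite (integralB mD I0 iG).
have -> : \int[lebesgue_measure]_(x in `[0%R, (2 * pi)%R]) (h 0%N x)%:E =
    ((2 * pi) * cmean (h 0%N))%:E.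
  by rewrite /cmean mulrA mulfV ?gt_eqF// mul1r /Rintegral fineK.
have fG := integrable_fin_num mD iG.
rewrite -(fineK fG) in IG *; move: IG; rewrite -EFinB -EFinM !lee_fin => IG.
rewrite -[a](mulKf (lt0r_neq0 p2)) ler_pM2l ?invr_gt0//.
by rewrite mulrBr in IG; lra.
Unshelve. all: by end_near. Qed.

End CircleMean.

(** * Convexity in logarithmic coordinates *)

Lemma ln_cabs1D (R : realType) (w : Cx R) :
  cabs w <= 4^-1 -> `|ln (cabs (1 + w))| <= 3 * cabs w.
Proof.
move=> w4; have w0 := cabs_ge0 w.
have u1 : cabs (1 + w) <= 1 + cabs w by have := cabsD 1 w; rewrite cabs1.
have l1 : 1 - cabs w <= cabs (1 + w).
  by have := cabsD (1 + w) (- w); rewrite addrK cabsN cabs1; lra.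
have p0 : 0 < cabs (1 + w) by lra.
have i0 : 0 < (cabs (1 + w))^-1 by rewrite invr_gt0.
have ci : cabs (1 + w) * (cabs (1 + w))^-1 = 1 by rewrite mulfV ?gt_eqF.
have h1 : ln (cabs (1 + w)) <= cabs (1 + w) - 1.
  by have := @le_ln1Dx R (cabs (1 + w) - 1); rewrite [1 + (_ - 1)]addrC subrK; apply; lra.
have h2 : - ln (cabs (1 + w)) <= (cabs (1 + w))^-1 - 1.
  rewrite -lnV//.
  by have := @le_ln1Dx R ((cabs (1 + w))^-1 - 1); rewrite [1 + (_ - 1)]addrC subrK; apply; lra.
have h3 : (cabs (1 + w))^-1 - 1 <= 3 * cabs w by nra.
by rewrite ler_norml; apply/andP; split; lra.
Qed.

(** * Logarithmic circles to second order *)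

Section LogSubmean.
Context {R : realType}.
Implicit Types (x y w : R).

Definition logcirc (w x : R) : R := ln (cabs (1 + (w%:C)%C * cis x : Cx R)).

Lemma continuous_logcirc w : `|w| < 1 -> continuous (logcirc w).
Proof. by move=> w1; apply: continuous_ln_circle; rewrite cabs1 cabsR. Qed.

Lemma cmean_logcirc w : `|w| < 1 -> cmean (logcirc w) = 0.
Proof. by move=> w1; apply: cmean_ln_small; rewrite cabsR. Qed.

(** The squared modulus is 1 + u with u = 2 w cos x + w^2, and ln (1 + u) lies between u - 2 u^2 and
    u. *)
Lemma logcirc_approx w x : `|w| <= 4^-1 ->
  `|logcirc w x - w * cos x| <= 6 * w ^+ 2.
Proof.
move=> w4.
have c1 := cos_le1 x; have cm1 := cos_geN1 x.
have cs := cos2Dsin2 x.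
set u := 2 * (w * cos x) + w ^+ 2.
have uE : cabs (1 + (w%:C)%C * cis x : Cx R) ^+ 2 = 1 + u.
  rewrite cabs_sqr /= !mul0r subr0 addr0 add0r /u.
  transitivity (1 + 2 * (w * cos x) + w ^+ 2 * (cos x ^+ 2 + sin x ^+ 2)); first by ring.
  by rewrite cs mulr1 addrA.
move: w4; rewrite ler_norml => /andP[wl wu].
have wc : -4^-1 <= w * cos x <= 4^-1 by apply/andP; split; nra.
have wcw : (w * cos x) ^+ 2 <= w ^+ 2.
  by rewrite exprMn ler_piMr ?sqr_ge0//; nra.
have u2 : - 2^-1 <= u by rewrite /u; nra.
have p0 : 0 < cabs (1 + (w%:C)%C * cis x : Cx R).
  rewrite lt_def cabs_ge0 andbT; apply/eqP => c0.
  by move: uE; rewrite c0 expr0n/=; lra.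
have lE : 2 * logcirc w x = ln (1 + u) by rewrite -uE lnXn// mulr_natl.
have h1 : ln (1 + u) <= u by apply: le_ln1Dx; lra.
(* From ln (1 + u) >= 1 - 1 / (1 + u); this dominates u - 2 u^2 exactly because u >= -1/2. *)
have h2 : u - 2 * u ^+ 2 <= ln (1 + u).
  have u1 : 0 < 1 + u by lra.
  have v0 : 0 < (1 + u)^-1 by rewrite invr_gt0.
  have := @le_ln1Dx R ((1 + u)^-1 - 1).
  rewrite [1 + (_ - 1)]addrC subrK lnV// => /(_ ltac:(lra)).
  have : (1 + u) * (1 + u)^-1 = 1 by rewrite mulfV// gt_eqF.
  set v := (1 + u)^-1 => uv hv.
  have : u - 2 * u ^+ 2 <= 1 - v by nra.
  by lra.
(* 81/16 is (9/4)^2, since u = w (2 cos x + w) and |w| <= 1/4. *)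
have u3 : u ^+ 2 <= (81 / 16) * w ^+ 2.
  have : u ^+ 2 = 4 * (w * cos x) ^+ 2 + 4 * (w * cos x) * w ^+ 2 + w ^+ 2 * w ^+ 2.
    by rewrite /u; ring.
  move: wc => /andP[wc1 wc2].
  have w0 : 0 <= w ^+ 2 := sqr_ge0 w.
  have w16 : w ^+ 2 <= 16^-1 by nra.
  by nra.
have w0 : 0 <= w ^+ 2 := sqr_ge0 w.
have : u = 2 * (w * cos x) + w ^+ 2 by [].
by rewrite ler_norml => uu; apply/andP; split; lra.
Qed.

Lemma logcirc_bound w x : `|w| <= 4^-1 -> `|logcirc w x| <= 3 * `|w|.
Proof.
have <- : cabs ((w%:C)%C * cis x : Cx R) = `|w| by rewrite cabsM cabs_cis mulr1 cabsR.
exact: ln_cabs1D.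
Qed.

Lemma cmean_cos2 : cmean (fun x : R => cos x ^+ 2) = 2^-1.
Proof.
have cc : continuous (fun x : R => cos x ^+ 2).
  by move=> x; apply: (@cvgM R R); exact: continuous_cos.
have dc x : 0 <= x <= 2 * pi ->
    is_derive x 1 (fun x => 2^-1 * (x + sin x * cos x)) (cos x ^+ 2).
  move=> _.
  have -> : cos x ^+ 2 = 2^-1 * (1 + (sin x * (- sin x) + cos x * cos x)).
    by have := cos2Dsin2 x; nra.
  exact: (is_deriveZ 2^-1 (is_deriveD (is_derive_id x (1 : R))
    (is_deriveM (is_derive_sin x) (is_derive_cos x)))).
rewrite (cmeanE cc dc) mulr_natl sin2pi sin0 !mul0r !addr0 mulr0 subr0.
by rewrite mulrCA mulVf ?mulr1// gt_eqF// pmulrn_rgt0// pi_gt0.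
Qed.

End LogSubmean.

Section QuadraticMean.
Context {R : realType} (I : finType).
Variables (d : I -> R) (j0 : I) (D e : R).
Hypotheses (dj0 : d j0 != 0) (dD : forall k, `|d k| <= D) (D1 : 1 <= D).
Hypotheses (e0 : 0 < e) (e1 : e <= 1) (eD : e * D <= 4^-1).

(** On a logarithmic circle of radius [e] in the direction [d], [lam] is the displacement along [d],
    read off the coordinate [j0], and [y] is the remaining transverse displacement. Up to O(e^2),
    [lam] is e cos x and [y] is 0. *)
Let lam (x : R) : R := logcirc (e * d j0) x / d j0.
Let y k (x : R) : R := logcirc (e * d k) x - lam x * d k.

Let small k : `|e * d k| <= 4^-1.
Proof.
rewrite normrM (gtr0_norm e0); apply: le_trans eD.
by rewrite ler_pM2l.
Qed.

Let small1 k : `|e * d k| < 1.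
Proof. by apply: (le_lt_trans (small k)); lra. Qed.

Lemma continuous_tangent : continuous lam.
Proof. by move=> x; apply: cvgM; [exact: continuous_logcirc|exact: cvg_cst]. Qed.

Lemma continuous_normal k : continuous (y k).
Proof.
move=> x; apply: cvgB; first exact: continuous_logcirc.
by apply: cvgM; [exact: continuous_tangent|exact: cvg_cst].
Qed.

Let cmean_lam : cmean lam = 0.
Proof.
transitivity (cmean (fun x => (d j0)^-1 * logcirc (e * d j0) x)).
  by congr cmean; apply/funext => x; rewrite mulrC.
by rewrite cmeanZ ?cmean_logcirc ?mulr0//; exact: continuous_logcirc.
Qed.

Let cmean_y k : cmean (y k) = 0.
Proof.
have cl : continuous (fun x => lam x * d k).
  by move=> x; apply: cvgM; [exact: continuous_tangent|exact: cvg_cst].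
rewrite (cmeanB (continuous_logcirc (small1 k)) cl) cmean_logcirc//.
transitivity (0 - cmean (fun x => d k * lam x)).
  by congr (0 - cmean _); apply/funext => x; rewrite mulrC.
by rewrite cmeanZ ?cmean_lam ?mulr0 ?subr0//; exact: continuous_tangent.
Qed.

Let approx k x : `|logcirc (e * d k) x - e * d k * cos x| <= 6 * e ^+ 2 * `|d k| * D.
Proof.
apply: (le_trans (logcirc_approx x (small k))).
rewrite exprMn -!mulrA ler_pM2l// ler_pM2l//.
have -> : d k ^+ 2 = `|d k| * `|d k| by rewrite -expr2 real_normK ?num_real.
by rewrite ler_pM2l// ler_wpM2l.
Qed.

Let lam_approx x : `|lam x - e * cos x| <= 6 * e ^+ 2 * D.
Proof.
have -> : lam x - e * cos x = (logcirc (e * d j0) x - e * d j0 * cos x) / d j0.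
  by rewrite /lam; field.
rewrite normrM normfV ler_pdivrMr ?normr_gt0//.
by apply: (le_trans (approx j0 x)); rewrite mulrAC.
Qed.

Let y_bound k x : `|y k x| <= 12 * e ^+ 2 * D ^+ 2.
Proof.
have -> : y k x = (logcirc (e * d k) x - e * d k * cos x) - (lam x - e * cos x) * d k.
  by rewrite /y; ring.
apply: (le_trans (ler_normB _ _)); rewrite normrM.
have D0 : 0 <= D := le_trans ler01 D1.
have e20 : 0 <= e ^+ 2 by rewrite sqr_ge0.
have h1 := approx k x; have h2 := lam_approx x; have h3 := dD k.
have h4 : `|lam x - e * cos x| * `|d k| <= (6 * e ^+ 2 * D) * D by rewrite ler_pM.
have h5 : 6 * e ^+ 2 * `|d k| * D <= 6 * e ^+ 2 * D * D.
  by rewrite ler_wpM2r// ler_wpM2l// mulr_ge0.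
by rewrite expr2 !mulrA; lra.
Qed.

(** The linear terms have mean zero because [lam] and [y k] are combinations of [logcirc]. As cos^2
    has mean 1/2, the term in [lam ^+ 2] yields the main term with an error of order e^3; the
    squares of [y] are O(e^4), absorbed into e^3 by e <= 1. *)
Lemma cmean_quadratic (b delta K : R) (Y : I -> R) : 0 <= delta -> 0 <= K ->
  cmean (fun x => b * lam x + K * (\sum_k 2 * Y k * y k x)
                  - delta * lam x ^+ 2 + K * (\sum_k y k x ^+ 2)) <=
  - (delta * e ^+ 2 / 2) + (12 * delta * D + 144 * K * #|I|%:R * D ^+ 4) * e ^+ 3.
Proof.
move=> delta0 K0.
have cL : continuous (fun x => b * lam x).
  by move=> x; apply: cvgM; [exact: cvg_cst|exact: continuous_tangent].
have cYk k : continuous (fun x => 2 * Y k * y k x).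
  by move=> x; apply: cvgM; [exact: cvg_cst|exact: continuous_normal].
have cYs : continuous (fun x => \sum_k 2 * Y k * y k x) by exact: continuous_sumr.
have cY : continuous (fun x => K * (\sum_k 2 * Y k * y k x)).
  by move=> x; apply: cvgM; [exact: cvg_cst|exact: cYs].
have cC : continuous (fun x : R => cos x ^+ 2).
  by move=> x; apply: (@cvgM R R); exact: continuous_cos.
have cD : continuous (fun x : R => (- delta * e ^+ 2) * cos x ^+ 2).
  by move=> x; apply: cvgM; [exact: cvg_cst|exact: cC].
pose C := (12 * delta * D + 144 * K * #|I|%:R * D ^+ 4) * e ^+ 3.
have cCst : continuous (fun _ : R => C) by move=> x; exact: cvg_cst.
have c12 : continuous (fun x => b * lam x + K * (\sum_k 2 * Y k * y k x)).
  by move=> x; apply: cvgD; [exact: cL|exact: cY].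
have c34 : continuous (fun x : R => (- delta * e ^+ 2) * cos x ^+ 2 + C).
  by move=> x; apply: cvgD; [exact: cD|exact: cCst].
have cmE : - (delta * e ^+ 2 / 2) + C =
  cmean (fun x => (b * lam x + K * (\sum_k 2 * Y k * y k x))
                  + ((- delta * e ^+ 2) * cos x ^+ 2 + C)).
  have E1 : cmean (fun x => b * lam x) = 0.
    by rewrite (cmeanZ _ continuous_tangent) cmean_lam mulr0.
  have E2 : cmean (fun x => K * (\sum_k 2 * Y k * y k x)) = 0.
    rewrite (cmeanZ _ cYs) (cmean_sum _ cYk) big1 ?mulr0// => k _.
    by rewrite (cmeanZ _ (continuous_normal (k := k))) cmean_y mulr0.
  by rewrite (cmeanD c12 c34) (cmeanD cL cY) (cmeanD cD cCst) E1 E2 (cmeanZ _ cC)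
    cmean_cst cmean_cos2 !add0r !mulNr.
rewrite -/C cmE; apply: cmean_le.
- move=> x; apply: cvgD; first apply: cvgB; first exact: c12.
    apply: cvgM; first exact: cvg_cst.
    by apply: (@cvgM R R); exact: continuous_tangent.
  apply: cvgM; first exact: cvg_cst.
  apply: (@continuous_sumr R R I (index_enum I) (fun k x => y k x ^+ 2)) => k z.
  by apply: (@cvgM R R); exact: continuous_normal.
- by move=> x; apply: cvgD; [exact: c12|exact: c34].
move=> x; rewrite -addrA lerD2l.
have D0 : 0 <= D := le_trans ler01 D1.
have l2 : e ^+ 2 * cos x ^+ 2 - 12 * e ^+ 3 * D <= lam x ^+ 2.
  have h := lam_approx x.
  set E := lam x - e * cos x in h *.
  have -> : lam x = e * cos x + E by rewrite /E; ring.
  have -> : (e * cos x + E) ^+ 2 = e ^+ 2 * cos x ^+ 2 + 2 * e * (cos x * E) + E ^+ 2 by ring.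
  have : `|cos x * E| <= 6 * e ^+ 2 * D.
    rewrite normrM; apply: le_trans h; rewrite ler_piMl//.
    by rewrite ler_norml cos_geN1 cos_le1.
  rewrite ler_norml => /andP[h1 _].
  have : e * (- (6 * e ^+ 2 * D)) <= e * (cos x * E) by rewrite ler_pM2l.
  have := sqr_ge0 E.
  have -> : e ^+ 3 = e * e ^+ 2 by rewrite exprS.
  by lra.
have s2 : \sum_k y k x ^+ 2 <= 144 * #|I|%:R * D ^+ 4 * e ^+ 3.
  apply: (@le_trans _ _ (\sum_(k : I) (144 * D ^+ 4 * e ^+ 3))).
    apply: ler_sum => k _.
    rewrite -real_normK ?num_real//.
    apply: (@le_trans _ _ ((12 * e ^+ 2 * D ^+ 2) ^+ 2)).
      apply: lerXn2r; rewrite ?nnegrE//.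
      by rewrite mulr_ge0 ?sqr_ge0// mulr_ge0 ?sqr_ge0.
    have -> : (12 * e ^+ 2 * D ^+ 2) ^+ 2 = 144 * D ^+ 4 * e ^+ 3 * e by ring.
    have pe0 := exprn_ge0 3 (ltW e0); have pD0 := exprn_ge0 4 D0.
    by rewrite ler_piMr// mulr_ge0// mulr_ge0.
  by rewrite sumr_const -[X in X <= _]mulr_natr le_eqVlt; apply/orP; left; apply/eqP; ring.
have l3 : delta * (e ^+ 2 * cos x ^+ 2 - 12 * e ^+ 3 * D) <= delta * lam x ^+ 2.
  by rewrite ler_wpM2l.
have s3 : K * (\sum_k y k x ^+ 2) <= K * (144 * #|I|%:R * D ^+ 4 * e ^+ 3).
  by rewrite ler_wpM2l.
by rewrite /C; lra.
Qed.

End QuadraticMean.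

Lemma lte_between (R : realType) (x : \bar R) (a : R) :
  (x < a%:E)%E -> exists2 b : R, (x < b%:E)%E & b < a.
Proof.
case: x => [u|//|]; last by exists (a - 1); rewrite ?ltNyr//; lra.
by rewrite lte_fin => ua; exists ((u + a) / 2); rewrite ?lte_fin; lra.
Qed.

(* If convexity failed on the segment [p, q], then phi - Psi would have a
   positive interior near-maximum on a tube around the segment, for
   Psi = affine + delta lam (1 - lam) + K |y|^2 with lam the position along the
   segment and y the deviation from it.  But Psi has mean at most
   Psi - delta e^2 / 4 on small logarithmic circles in the direction q - p. *)
Lemma log_submean_convex (R : realType) (I : finType) (Om : set (I -> R))
    (phi : (I -> R) -> \bar R) :
  (forall p q (l : R), Om p -> Om q -> 0 <= l <= 1 ->
     Om (fun j => (1 - l) * p j + l * q j)) ->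
  (forall p, Om p ->
     exists2 r : R, 0 < r & forall x, (forall j, `|x j - p j| < r) -> Om x) ->
  (forall x, Om x -> (phi x <= 0)%E) ->
  (forall p (a : R), Om p -> (phi p < a%:E)%E ->
     exists2 r : R, 0 < r &
       forall x, Om x -> (forall j, `|x j - p j| < r) -> (phi x < a%:E)%E) ->
  (forall x d (h : R -> R), Om x -> (forall j, `|d j| <= 4^-1) ->
     (forall z, (forall j, `|z j - x j| <= 3 * `|d j|) -> Om z) ->
     continuous h ->
     (forall t, (phi (fun j => x j + logcirc (d j) t)%R <= (h t)%:E)%E) ->
     (phi x <= (cmean h)%:E)%E) ->
  forall p q (l A B : R), Om p -> Om q -> 0 < l < 1 ->
  (phi p < A%:E)%E -> (phi q < B%:E)%E ->
  (phi (fun j => (1 - l) * p j + l * q j)%R <= ((1 - l) * A + l * B)%:E)%E.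
Proof.
move=> cvx opn phi0 usc sub p q l A B Omp Omq /andP[l0 l1] pA qB.
case: (pselect (exists j, p j != q j)) => [[j0 pq0]|npq]; last first.
  have pq : p = q.
    by apply/funext => j; apply/eqP; apply: contrapT => /negP pqj; apply: npq; exists j.
  rewrite -pq in qB *.
  have -> : (fun j => (1 - l) * p j + l * p j) = p by apply/funext => j; ring.
  case: (phi p) pA qB => [c| |]; rewrite ?leNye ?lte_fin ?lee_fin//.
  by move=> cA cB; nra.
rewrite leNgt; apply/negP => hm.
set m := (fun j => _) in hm.
have Omm : Om m by apply: cvx => //; rewrite !ltW.
have [c mc] : exists c : R, phi m = c%:E.
  move: hm (phi0 m Omm); case: (phi m) => [c| |]//; by exists c.
rewrite mc lte_fin in hm.
(* The amount by which convexity fails at [m]; it also serves as the concavity coefficient delta of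
   the barrier. *)
pose g := c - ((1 - l) * A + l * B).
have g0 : 0 < g by rewrite subr_gt0.
pose d j := q j - p j.
have dj0 : d j0 != 0 by rewrite subr_eq0 eq_sym.
pose lam (x : I -> R) := (x j0 - p j0) / d j0.
pose y x k := x k - p k - lam x * d k.
pose D := 1 + \sum_k `|d k|.
have S0 : 0 <= \sum_k `|d k| by apply: sumr_ge0.
have D1 : 1 <= D by rewrite lerDl.
have D0 : 0 < D by apply: lt_le_trans D1.
have dD k : `|d k| <= D.
  rewrite /D (bigD1 k)//= addrCA lerDl addr_ge0//.
  by apply: sumr_ge0.
have [A' pA' AA] := lte_between pA; have [B' qB' BB] := lte_between qB.
have [r1 r10 or1] := opn p Omp; have [r2 r20 or2] := opn q Omq.
have [r3 r30 or3] := usc p A' Omp pA'; have [r4 r40 or4] := usc q B' Omq qB'.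
have minpos (u v : R) : 0 < u -> 0 < v -> exists w, [/\ 0 < w, w <= u & w <= v].
  move=> u0 v0; exists (Num.min u v).
  by rewrite lt_min u0 v0 !ge_min !lexx orbT.
have [r12 [r120 r121 r122]] := minpos _ _ r10 r20.
have [r34 [r340 r343 r344]] := minpos _ _ r30 r40.
have [r [r0 rr12 rr34]] := minpos _ _ r120 r340.
pose rho := r / 4.
have rho0 : 0 < rho by rewrite divr_gt0.
have [k1 [k10 k1A k1B]] : exists w, [/\ 0 < w, w <= A - A' & w <= B - B'].
  by apply: minpos; rewrite subr_gt0.
have [k2 [k20 k2a k2b]] : exists w, [/\ 0 < w, w <= k1 / (1 + `|B - A|) & w <= 2^-1].
  by apply: minpos => //; rewrite divr_gt0// ltr_pwDl.
(* Within [kap] of an end of the segment, the affine part of [Psi] moves by no more than the slack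
   [A - A'] or [B - B'], and the points of the tube stay in the neighbourhood where [A'] or [B']
   bounds [phi]. *)
have [kap [kap0 kapa kapb]] : exists w, [/\ 0 < w, w <= k2 & w <= rho / D].
  by apply: minpos => //; rewrite divr_gt0.
have kapBA : kap * `|B - A| <= k1.
  have : kap <= k1 / (1 + `|B - A|) by apply: le_trans k2a.
  rewrite ler_pdivlMr ?ltr_pwDl// mulrDr mulr1; move: kap0; clear; lra.
have kapD k : kap * `|d k| <= rho.
  apply: (@le_trans _ _ (kap * D)); first by rewrite ler_pM2l.
  by rewrite -ler_pdivlMr.
have kap2 : kap <= 2^-1 by apply: le_trans k2b.
(* At transverse distance [rho / 2] the penalty equals |A| + |B|, which lifts [Psi] to at least 0,
   hence above [phi]. *)
pose K := 4 * (`|A| + `|B|) / rho ^+ 2.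
have K0 : 0 <= K by rewrite divr_ge0 ?sqr_ge0// mulr_ge0// addr_ge0.
pose Psi x := A + (B - A) * lam x + g * lam x * (1 - lam x) + K * (\sum_k y x k ^+ 2).
pose T x := 0 <= lam x <= 1 /\ forall k, `|y x k| <= rho.
have xE x k : x k = p k + lam x * d k + y x k by rewrite /y; ring.
have TOm x : T x -> Om x.
  move=> [lx yx].
  (* A point of the tube lies on the segment between the two ends, both translated by its transverse
     part [y x]. *)
  have -> : x = fun j => (1 - lam x) * (p j + y x j) + lam x * (q j + y x j).
    by apply/funext => j; rewrite {1}(xE x j) /d; ring.
  apply: cvx => //; [apply: or1|apply: or2] => j; rewrite addrC addKr;
    by apply: (le_lt_trans (yx j)); move: rr12 r121 r122 r0; rewrite /rho; clear; lra.
have aff x : 0 <= lam x <= 1 -> - (`|A| + `|B|) <= A + (B - A) * lam x.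
  move=> /andP[lx0 lx1].
  have -> : A + (B - A) * lam x = (1 - lam x) * A + lam x * B by ring.
  have h1 : - `|A| <= (1 - lam x) * A.
    move: lx0 lx1 (ler_norm (- A)) (normr_ge0 A); rewrite normrN; clear; nra.
  have h2 : - `|B| <= lam x * B.
    move: lx0 lx1 (ler_norm (- B)) (normr_ge0 B); rewrite normrN; clear; nra.
  by move: h1 h2; clear; lra.
have sumy0 x : 0 <= \sum_k y x k ^+ 2 by apply: sumr_ge0 => k _; exact: sqr_ge0.
have Psilow x : 0 <= lam x <= 1 -> A + (B - A) * lam x + K * (\sum_k y x k ^+ 2) <= Psi x.
  move=> /andP[lx0 lx1]; rewrite /Psi lerD2r lerDl mulr_ge0 ?subr_ge0//.
  by rewrite mulr_ge0// ltW.
have Psilow' x : 0 <= lam x <= 1 -> A + (B - A) * lam x <= Psi x.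
  by move=> lx; apply: le_trans (Psilow x lx); rewrite lerDl mulr_ge0.
(* Points where [phi - Psi] is positive keep a fixed distance from the ends and from the lateral
   boundary of the tube, so small circles around them remain inside. *)
have interior x (a : R) : T x -> 0 < a -> ((a + Psi x)%:E <= phi x)%E ->
    [/\ kap < lam x, lam x < 1 - kap & forall k, `|y x k| < rho / 2].
  move=> Tx a0 aphi; have [/[dup] lx01 /andP[lx0 lx1] yx] := Tx.
  have Omx := TOm x Tx.
  have nBA := normr_ge0 (B - A).
  have dBA := ler_norm (B - A); have dAB := ler_norm (- (B - A)); rewrite normrN in dAB.
  split.
  - rewrite ltNge; apply/negP => lk.
    have : (phi x < A'%:E)%E.
      apply: or3 => // k; rewrite (xE x k).
      have -> : p k + lam x * d k + y x k - p k = lam x * d k + y x k by ring.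
      apply: (le_lt_trans (ler_normD _ _)); rewrite normrM (ger0_norm lx0).
      have lkd : lam x * `|d k| <= kap * `|d k| by rewrite ler_wpM2r.
      move: (kapD k) (yx k) lkd r343 rr34 r0; rewrite /rho; clear; lra.
    move/(le_lt_trans aphi); rewrite lte_fin ltNge => /negP; apply.
    have : - (kap * `|B - A|) <= (B - A) * lam x.
      move: nBA dBA dAB lx0 lk; clear; nra.
    move: (Psilow' x lx01) kapBA k1A a0; clear; lra.
  - rewrite ltNge; apply/negP => lk.
    have : (phi x < B'%:E)%E.
      apply: or4 => // k; rewrite (xE x k).
      have -> : p k + lam x * d k + y x k - q k = - ((1 - lam x) * d k) + y x k.
        by rewrite /d; ring.
      have lx1' : 0 <= 1 - lam x by rewrite subr_ge0.
      apply: (le_lt_trans (ler_normD _ _)); rewrite normrN normrM (ger0_norm lx1').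
      have lkd : (1 - lam x) * `|d k| <= kap * `|d k|.
        by rewrite ler_wpM2r// lerBlDr -lerBlDl.
      move: (kapD k) (yx k) lkd r344 rr34 r0; rewrite /rho; clear; lra.
    move/(le_lt_trans aphi); rewrite lte_fin ltNge => /negP; apply.
    have : - (kap * `|B - A|) <= - ((B - A) * (1 - lam x)).
      move: nBA dBA dAB lx1 lk; clear; nra.
    move: (Psilow' x lx01) kapBA k1B a0; clear; lra.
  - move=> k; rewrite ltNge; apply/negP => yk.
    have := le_trans aphi (phi0 x Omx); rewrite lee_fin leNgt => /negP; apply.
    have h1 := Psilow x lx01; have h2 := aff x lx01.
    have h3 : `|A| + `|B| <= K * (\sum_k y x k ^+ 2).
      apply: (@le_trans _ _ (K * (rho / 2) ^+ 2)).
        rewrite /K le_eqVlt; apply/orP; left; apply/eqP; field.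
        by rewrite gt_eqF.
      rewrite ler_wpM2l// (bigD1 k)//= -[y x k ^+ 2]real_normK ?num_real//.
      apply: (@le_trans _ _ (`|y x k| ^+ 2)); last first.
        by rewrite lerDl sumr_ge0// => i _; exact: sqr_ge0.
      by apply: lerXn2r; rewrite ?nnegrE// divr_ge0// ltW.
    move: h1 h2 h3 a0; clear; lra.
have lamm : lam m = l by rewrite /lam /m /d; field; rewrite subr_eq0 eq_sym.
have ym k : y m k = 0 by rewrite /y lamm /m /d; ring.
have Tm : T m.
  by split; [rewrite lamm !ltW|move=> k; rewrite ym normr0 ltW].
pose S : set R := [set a | exists2 x, T x & ((a + Psi x)%:E <= phi x)%E].
(* At [m] the excess over the barrier is g - g l (1 - l), still positive because l (1 - l) < 1. *)
have [g' g'0 Sg'] : exists2 g', 0 < g' & S g'.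
  exists (g - g * l * (1 - l)); first by move: g0 l0 l1; clear; nra.
  exists m => //; rewrite mc lee_fin /Psi lamm.
  rewrite big1 ?mulr0 ?addr0; last by move=> k _; rewrite ym expr0n.
  by rewrite /g; clear; lra.
have Sub : ubound S (`|A| + `|B|).
  move=> a [x Tx ax]; have := le_trans ax (phi0 x (TOm x Tx)); rewrite lee_fin.
  by have [lx _] := Tx; move: (Psilow' x lx) (aff x lx); clear; lra.
have hS : has_sup S by split; [exists g'|exists (`|A| + `|B|)].
pose M := sup S.
have M0 : 0 < M by apply: (lt_le_trans g'0); apply: ub_le_sup => //; exists (`|A| + `|B|).
have TM x : T x -> (phi x <= (M + Psi x)%:E)%E.
  move=> Tx; have := phi0 x (TOm x Tx).
  case phix : (phi x) => [u| |]; rewrite ?leNye// => _.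
  rewrite lee_fin -lerBlDr; apply: ub_le_sup; first by exists (`|A| + `|B|).
  by exists x => //; rewrite phix subrK.
pose C := 12 * g * D + 144 * K * #|I|%:R * D ^+ 4.
have C0 : 0 <= C.
  have D40 := exprn_gt0 4 D0.
  apply: addr_ge0; apply: mulr_ge0; rewrite ?(ltW D40) ?(ltW D0)//.
    by apply: mulr_ge0 => //; exact: ltW.
  by apply: mulr_ge0 => //; apply: mulr_ge0.
(* Requirements on the radius: 3 e <= kap and 6 e D <= rho / 2 keep the circle in the tube, e D <=
   1/4 validates the expansions, and C e <= g / 4 makes the cubic error at most half of the gain g
   e^2 / 2. *)
have [e1 [e10 e11 e1D]] : exists w, [/\ 0 < w, w <= 1 & w <= (4^-1) / D].
  by apply: minpos => //; rewrite divr_gt0.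
have [e2 [e20 e21 e2k]] : exists w, [/\ 0 < w, w <= e1 & w <= kap / 3].
  by apply: minpos => //; rewrite divr_gt0.
have [e3 [e30 e32 e3r]] : exists w, [/\ 0 < w, w <= e2 & w <= rho / (12 * D)].
  by apply: minpos => //; rewrite divr_gt0// mulr_gt0.
have [e [e0 e3e eC]] : exists w, [/\ 0 < w, w <= e3 & w <= (g / 4) / (1 + C)].
  by apply: minpos => //; rewrite divr_gt0// ?divr_gt0// ltr_pwDl.
have ee2 : e <= e2 := le_trans e3e e32.
have ee1 : e <= e1 := le_trans ee2 e21.
have e_le1 : e <= 1 := le_trans ee1 e11.
have eD : e * D <= 4^-1 by rewrite -ler_pdivlMr//; exact: le_trans e1D.
have ek : 3 * e <= kap by move: ee2 e2k; clear; lra.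
have er : 6 * (e * D) <= rho / 2.
  have := le_trans e3e e3r.
  by rewrite ler_pdivlMr ?mulr_gt0//; clear; lra.
have eCg : C * e <= g / 4.
  move: eC; rewrite ler_pdivlMr ?ltr_pwDl// mulrDr mulr1; move: e0; clear; lra.
(* The supremum need not be attained, so a near-maximum is taken whose defect is below the net gain
   g e^2 / 4; [eta <= M] keeps its value positive. *)
have [eta [eta0 etag etaM]] : exists w, [/\ 0 < w, w <= g * e ^+ 2 / 4 & w <= M].
  by apply: minpos => //; rewrite divr_gt0// mulr_gt0// exprn_gt0.
have [a [x Tx ax] Ma] := sup_adherent eta0 hS.
rewrite -/M in Ma.
have a0 : 0 < a by move: Ma etaM; clear; lra.
have [kx1 kx2 yx] := interior x a Tx a0 ax.
pose dd k := e * d k.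
have dd4 k : `|dd k| <= 4^-1.
  rewrite normrM (gtr0_norm e0); apply: le_trans eD.
  by rewrite ler_pM2l.
have near z : (forall j, `|z j - x j| <= 3 * `|dd j|) -> T z.
  move=> zx.
  have dl : `|lam z - lam x| <= 3 * e.
    have -> : lam z - lam x = (z j0 - x j0) / d j0 by rewrite /lam; field.
    rewrite normrM normfV ler_pdivrMr ?normr_gt0//.
    by apply: (le_trans (zx j0)); rewrite normrM (gtr0_norm e0) mulrA.
  split.
    by move: dl; rewrite ler_norml => /andP[dl1 dl2]; apply/andP; split;
      move: dl1 dl2 ek kx1 kx2; clear; lra.
  move=> k.
  have -> : y z k = y x k + ((z k - x k) - (lam z - lam x) * d k) by rewrite /y; ring.
  apply: (le_trans (ler_normD _ _)).
  have h1 : `|(z k - x k) - (lam z - lam x) * d k| <= 6 * (e * D).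
    apply: (le_trans (ler_normB _ _)); rewrite normrM.
    have := zx k; rewrite normrM (gtr0_norm e0).
    have : e * `|d k| <= e * D by rewrite ler_pM2l.
    have : `|lam z - lam x| * `|d k| <= (3 * e) * `|d k| by rewrite ler_wpM2r.
    by clear; lra.
  by move: (yx k) h1 er; clear; lra.
pose L t := fun j => x j + logcirc (dd j) t.
have TL t : T (L t).
  by apply: near => j; rewrite /L addrC addKr logcirc_bound.
pose tau t := logcirc (e * d j0) t / d j0.
pose nu k t := logcirc (e * d k) t - tau t * d k.
(* Derivative at [x], in the variable [lam], of the affine and concave parts of [Psi]. *)
pose b := (B - A) + g * (1 - 2 * lam x).
pose quad t := b * tau t + K * (\sum_k 2 * y x k * nu k t) - g * tau t ^+ 2
               + K * (\sum_k nu k t ^+ 2).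
have PsiL t : Psi (L t) = Psi x + quad t.
  have lamL : lam (L t) = lam x + tau t by rewrite /lam /tau /L /dd; field.
  have yL k : y (L t) k = y x k + nu k t by rewrite /y lamL /nu /L /dd; ring.
  have -> : Psi (L t) = A + (B - A) * lam (L t) + g * lam (L t) * (1 - lam (L t)) +
      K * (\sum_k (y x k ^+ 2 + 2 * y x k * nu k t + nu k t ^+ 2)).
    by rewrite /Psi; congr (_ + K * _); apply: eq_bigr => k _; rewrite yL; ring.
  by rewrite !big_split/= lamL /Psi /quad /b; ring.
have ctau : continuous tau by exact: continuous_tangent.
have cnu k : continuous (nu k) by exact: continuous_normal.
have cquad : continuous quad.
  move=> t; apply: cvgD; first apply: cvgB; first apply: cvgD.
  - by apply: cvgM; [exact: cvg_cst|exact: ctau].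
  - apply: cvgM; first exact: cvg_cst.
    apply: (@continuous_sumr R R I (index_enum I) (fun k t => 2 * y x k * nu k t)) => k z.
    by apply: cvgM; [exact: cvg_cst|exact: cnu].
  - apply: cvgM; first exact: cvg_cst.
    by apply: (@cvgM R R); exact: ctau.
  - apply: cvgM; first exact: cvg_cst.
    apply: (@continuous_sumr R R I (index_enum I) (fun k t => nu k t ^+ 2)) => k z.
    by apply: (@cvgM R R); exact: cnu.
have ccst (u : R) : continuous (fun _ : R => u) by move=> t; exact: cvg_cst.
(* The submean inequality at [x] gives a <= M + mean of [quad], while this mean is at most -eta and
   a > M - eta. *)
have := sub x dd (fun t => (M + Psi x) + quad t) (TOm x Tx) dd4 (fun z zx => TOm z (near z zx)).
rewrite (cmeanD (ccst _) cquad) cmean_cst => /(_ _ _)/wrap[].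
- by move=> t; apply: cvgD; [exact: cvg_cst|exact: cquad].
- move=> t; have -> : M + Psi x + quad t = M + Psi (L t).
    by rewrite (PsiL t); symmetry; exact: addrA.
  exact: (TM _ (TL t)).
move/(le_trans ax); rewrite lee_fin leNgt => /negP; apply.
have := cmean_quadratic dj0 dD D1 e0 e_le1 eD b (y x) (ltW g0) K0.
rewrite -/C -/quad => hq.
have hC : C * e ^+ 3 <= g / 4 * e ^+ 2.
  by rewrite exprS mulrA ler_wpM2r// sqr_ge0.
have hq' : cmean quad <= - (g * e ^+ 2 / 2) + C * e ^+ 3 by exact: hq.
by move: hC hq' etag Ma; rewrite -/C; move: (C * e ^+ 3) => Ce; clear; lra.
Qed.

(** * Supporting hyperplanes *)

(** Hahn-Banach extension by one coordinate at a time: the first [k] coordinates are free, the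
    others frozen at [s]. A slope in the new direction must separate the left difference quotients
    from the right ones; the supremum of the left ones does. *)
Lemma supporting_hyperplane (R : realType) (n : nat) (Om : set ('I_n -> R))
    (f : ('I_n -> R) -> R) (s : 'I_n -> R) :
  (forall p q (l : R), Om p -> Om q -> 0 <= l <= 1 ->
     Om (fun j => (1 - l) * p j + l * q j)) ->
  (forall p, Om p ->
     exists2 r : R, 0 < r & forall x, (forall j, `|x j - p j| < r) -> Om x) ->
  (forall p q (l : R), Om p -> Om q -> 0 < l < 1 ->
     f (fun j => (1 - l) * p j + l * q j) <= (1 - l) * f p + l * f q) ->
  Om s ->
  exists y : 'I_n -> R, forall x, Om x -> f s + \sum_j (x j - s j) * y j <= f x.
Proof.
move=> cvxO opn cvxf Os.
suff H k : (k <= n)%N -> exists y : 'I_n -> R,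
    (forall i : 'I_n, (k <= i)%N -> y i = 0) /\
    forall x, (forall i : 'I_n, (k <= i)%N -> x i = s i) -> Om x ->
      f s + \sum_j (x j - s j) * y j <= f x.
  have [y [_ hy]] := H n (leqnn n); exists y => x Ox; apply: hy => // i.
  by rewrite leqNgt ltn_ord.
elim: k => [_|k IH kn].
  exists (fun=> 0); split=> // x xs _.
  have -> : x = s by apply/funext => i; exact: xs.
  by rewrite big1 ?addr0// => i _; rewrite mulr0.
have [y [y0 hy]] := IH (ltnW kn).
pose j : 'I_n := Ordinal kn.
pose ip (x : 'I_n -> R) := \sum_i (x i - s i) * y i.
pose adm (x : 'I_n -> R) := (forall i : 'I_n, (k < i)%N -> x i = s i) /\ Om x.
(* The point of the segment from [x] to [z] whose [j]-th coordinate is [s j] lies in the slice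
   already treated. *)
have key x z : adm x -> adm z -> x j < s j -> s j < z j ->
    (f s + ip x - f x) / (s j - x j) <= (f z - f s - ip z) / (z j - s j).
  move=> [xs Ox] [zs Oz] xj zj.
  set tau := s j - x j; set sig := z j - s j.
  have tau0 : 0 < tau by rewrite subr_gt0.
  have sig0 : 0 < sig by rewrite subr_gt0.
  have ts0 : tau + sig != 0 by rewrite gt_eqF// addr_gt0.
  pose l := tau / (tau + sig).
  have l01 : 0 < l < 1.
    have tsg := addr_gt0 tau0 sig0.
    by apply/andP; split; [rewrite divr_gt0|rewrite ltr_pdivrMr// mul1r ltrDl].
  have l1 : (tau + sig) * l = tau by rewrite mulrC divfK.
  pose w i := (1 - l) * x i + l * z i.
  have wj : w j = s j.
    have -> : w j = s j + ((1 - l) * - tau + l * sig) by rewrite /w /tau /sig; ring.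
    suff -> : (1 - l) * - tau + l * sig = 0 by rewrite addr0.
    have -> : (1 - l) * - tau + l * sig = (tau + sig) * l - tau by ring.
    by rewrite l1 subrr.
  have Ow : Om w by apply: cvxO => //; case/andP: l01 => /ltW -> /ltW ->.
  have hw : f s + ip w <= f w.
    apply: hy => // i; rewrite leq_eqVlt => /predU1P[ki|ki].
      by have -> : i = j by apply: val_inj.
    by rewrite /w xs// zs//; ring.
  have ipw : ip w = (1 - l) * ip x + l * ip z.
    by rewrite /ip !big_distrr/= -big_split/=; apply: eq_bigr => i _; rewrite /w; ring.
  have := le_trans hw (cvxf _ _ _ Ox Oz l01); rewrite ipw => {}hw.
  rewrite ler_pdivrMr// mulrAC ler_pdivlMr//.
  have := ler_wpM2l (ltW (addr_gt0 tau0 sig0)) hw.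
  have -> : (tau + sig) * (f s + ((1 - l) * ip x + l * ip z)) =
    sig * (f s + ip x) + tau * (f s + ip z).
    transitivity ((tau + sig) * f s + ((tau + sig) - (tau + sig) * l) * ip x
      + (tau + sig) * l * ip z); first by ring.
    by rewrite l1; ring.
  have -> : (tau + sig) * ((1 - l) * f x + l * f z) = sig * f x + tau * f z.
    transitivity (((tau + sig) - (tau + sig) * l) * f x
      + (tau + sig) * l * f z); first by ring.
    by rewrite l1; ring.
  clear; lra.
pose shift (a : R) i := if i == j then s j + a else s i.
(* Openness supplies admissible points on both sides of [s], so the set of left quotients is
   nonempty and bounded above. *)
have shift_adm : exists2 a : R, 0 < a & adm (shift a) /\ adm (shift (- a)).
  have [r r0 rO] := opn s Os.
  have sh a : `|a| < r -> adm (shift a).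
    move=> ar; split=> [i ki|].
      by rewrite /shift; case: eqP => // ij; move: ki; rewrite ij ltnn.
    apply: rO => i; rewrite /shift; case: eqP => [->|_]; last by rewrite subrr normr0.
    by rewrite addrC addKr.
  have r2 : `|r / 2| < r by rewrite gtr0_norm ?divr_gt0// ltr_pdivrMr//; move: r0; clear; lra.
  by exists (r / 2); [rewrite divr_gt0|split; apply: sh; rewrite ?normrN].
have [a a0 [adma admNa]] := shift_adm.
have shj b : shift b j = s j + b by rewrite /shift eqxx.
pose E : set R :=
  [set b | exists x, [/\ adm x, x j < s j & b = (f s + ip x - f x) / (s j - x j)]].
have ubE z : adm z -> s j < z j -> ubound E ((f z - f s - ip z) / (z j - s j)).
  by move=> az zj _ [x [ax xj ->]]; exact: key.
have E0 : E !=set0.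
  exists ((f s + ip (shift (- a)) - f (shift (- a))) / (s j - shift (- a) j)).
  by exists (shift (- a)); split=> //; rewrite shj gtrDl oppr_lt0.
have hE : has_ubound E.
  exists ((f (shift a) - f s - ip (shift a)) / (shift a j - s j)).
  by apply: ubE => //; rewrite shj ltrDl.
pose c := sup E.
exists (fun i => if i == j then c else y i); split=> [i ki|x xs Ox].
  case: eqP => [ij|_]; first by move: ki; rewrite ij ltnn.
  by rewrite y0// ltnW.
have yj : y j = 0 by apply: y0.
have -> : \sum_i (x i - s i) * (if i == j then c else y i) = ip x + (x j - s j) * c.
  rewrite /ip (bigD1 j)//= eqxx [in RHS](bigD1 j)//= yj mulr0 add0r addrC.
  by congr (_ + _); apply: eq_bigr => i /negPf ->.
have ax : adm x by [].
have [xj|xj|xj] := ltgtP (x j) (s j).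
- have : (f s + ip x - f x) / (s j - x j) <= c by apply: ub_le_sup => //; exists x.
  by rewrite ler_pdivrMr ?subr_gt0//; clear; lra.
- have : c <= (f x - f s - ip x) / (x j - s j) by apply: ge_sup => //; exact: ubE.
  by rewrite ler_pdivlMr ?subr_gt0//; clear; lra.
- rewrite xj subrr mul0r addr0; apply: hy => // i.
  rewrite leq_eqVlt => /predU1P[ki|/xs//].
  by have -> : i = j by apply: val_inj.
Qed.

(** * The geodesic in logarithmic coordinates *)

Section Neighbourhoods.
Context {R : realType} {n : nat}.
Implicit Types (z w : 'rV[Cx R]_n) (zeta : Cx R).

Lemma nbhs_rVCxP z (P : set 'rV[Cx R]_n) :
  nbhs z P <->
  exists2 e : R, 0 < e & forall w, (forall j, cabs (z ord0 j - w ord0 j) < e) -> P w.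
Proof.
split=> [/nbhs_ballP[e /= e0 eP]|[e e0 eP]]; last apply/nbhs_ballP.
- have /eqP eI : complex.Im e == 0 by move: e0; rewrite ltcE => /andP[].
  exists (complex.Re e); first by move: e0; rewrite ltcE => /andP[].
  move=> w zw; apply: eP; split=> // i j; rewrite ord1 /ball/= normCx.
  by rewrite ltcE /= eI eqxx; exact: zw.
- exists (e%:C)%C; first by rewrite /= ltcR.
  move=> w [_ zw]; apply: eP => j; have := zw ord0 j.
  by rewrite /ball/= normCx ltcR.
Qed.

Lemma nbhs_prodCxP z zeta (P : set ('rV[Cx R]_n * Cx R)) :
  nbhs (z, zeta) P <->
  exists2 e : R, 0 < e & forall w xi, (forall j, cabs (z ord0 j - w ord0 j) < e) ->
    cabs (zeta - xi) < e -> P (w, xi).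
Proof.
split=> [[[/= A B] [/nbhs_rVCxP[e e0 eA] /nbhs_CxP[f f0 fB]] AB]|[e e0 eP]].
- exists (Num.min e f); first by rewrite lt_min e0.
  move=> w xi zw zx; apply: AB; split=> /=.
    by apply: eA => j; have := zw j; rewrite lt_min => /andP[].
  by apply: fB; move: zx; rewrite lt_min => /andP[].
- exists ([set w : 'rV[Cx R]_n | forall j, cabs (z ord0 j - w ord0 j) < e],
    [set xi | cabs (zeta - xi) < e]).
    by split; [apply/nbhs_rVCxP; exists e|apply/nbhs_CxP; exists e].
  by move=> [w xi] [/= hw hx]; exact: eP.
Qed.

End Neighbourhoods.

(** Transfers semicontinuity to logarithmic coordinates; all of them, ln |zeta| included, stay below
    1. *)
Lemma expR_lip (R : realType) (x p : R) : x <= 1 -> p <= 1 ->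
  `|expR p - expR x| <= expR 1 * `|x - p|.
Proof.
have H (a b : R) : a <= 1 -> b <= a -> expR a - expR b <= expR 1 * (a - b).
  move=> a1 ab; apply: (@le_trans _ _ (expR a * (a - b))); last first.
    by rewrite ler_wpM2r ?subr_ge0// ler_expR.
  have -> : expR b = expR a * expR (b - a) by rewrite -expRD addrC subrK.
  have := expR_ge1Dx (b - a); have := expR_gt0 a; nra.
move=> x1 p1; have [xp|px] := leP x p.
  rewrite ger0_norm ?subr_ge0 ?ler_expR// distrC (ger0_norm (x := p - x)) ?subr_ge0//.
  exact: H.
rewrite distrC (ger0_norm (x := expR x - expR p)) ?subr_ge0 ?ler_expR ?(ltW px)//.
by rewrite ger0_norm ?subr_ge0 ?(ltW px)//; apply: H => //; exact: ltW.
Qed.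

Lemma convex_comb_lt (R : realFieldType) (l a b c : R) : 0 <= l <= 1 -> a < c -> b < c ->
  (1 - l) * a + l * b < c.
Proof.
move=> /andP[l0 l1] ac bc; rewrite -subr_gt0.
have -> : c - ((1 - l) * a + l * b) = (1 - l) * (c - a) + l * (c - b) by ring.
move: l0; rewrite le_eqVlt => /predU1P[<-|l0]; first by rewrite subr0 mul1r mul0r addr0 subr_gt0.
by rewrite ltr_wpDl// ?mulr_gt0 ?mulr_ge0 ?subr_gt0 ?subr_ge0// ltW.
Qed.

(** * Toric symmetry and joint convexity of the geodesic *)

Section GeodesicConvex.
Context {R : realType} {n : nat}.
Implicit Types (z w : 'rV[Cx R]_n).

Definition rotate (c : 'I_n -> Cx R) z : 'rV[Cx R]_n := \row_j (c j * z ord0 j).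

(** A coordinatewise rotation is linear and preserves all moduli: it maps complex lines to complex
    lines, fixes the polydisk, and leaves toric boundary data unchanged. *)
Lemma rotate_subgeodesic (u0 u1 : 'rV[Cx R]_n -> \bar R)
    (v : R -> 'rV[Cx R]_n -> \bar R) (c : 'I_n -> Cx R) :
  toric u0 -> toric u1 -> (forall j, cabs (c j) = 1) ->
  subgeodesic u0 u1 v -> subgeodesic u0 u1 (fun t z => v t (rotate c z)).
Proof.
move=> tor0 tor1 c1 [[v1 v2 v3] v4 v5 v6].
have Drot z : polydisk R n (rotate c z) = polydisk R n z.
  apply/propext; split=> h j; have := h j;
    by rewrite mxE cabsM c1 mul1r.
have rotc z j : cabs (rotate c z ord0 j) = cabs (z ord0 j).
  by rewrite mxE cabsM c1 mul1r.
split; first split.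
- move=> [z zeta] [/= Dz Az]; apply: (v1 (rotate c z, zeta)).
  by split => //=; rewrite Drot.
- move=> [z zeta] [/= Dz Az] a /= va.
  have D' : (polydisk R n `*` annulus R) (rotate c z, zeta).
    by split => //=; rewrite Drot.
  have /nbhs_prodCxP[e e0 he] := v2 _ D' a va.
  apply/nbhs_prodCxP; exists e => // w xi zw zx [/= Dw Ax].
  apply: (he (rotate c w) xi) => //; last by split => //=; rewrite Drot.
  by move=> j; rewrite !mxE -mulrBr cabsM c1 mul1r.
- move=> [a1 a2] [b1 b2].
  have := v3 (rotate c a1, a2) (rotate c b1, b2).
  have E tau : rotate c (a1 + tau *: b1) = rotate c a1 + tau *: rotate c b1.
    by apply/rowP => j; rewrite !mxE; ring.
  congr (subharmonic _ _).
    by apply/seteqP; split=> tau [/= h1 h2]; split => //=; move: h1;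
       rewrite -E Drot.
  by apply/funext => tau /=; rewrite -E.
- by move=> [z zeta] [/= Dz Az]; apply: (v4 (rotate c z, zeta)); split; rewrite //= Drot.
- move=> z Dz; have Drz : polydisk R n (rotate c z) by rewrite Drot.
  by rewrite -(tor0 _ _ Drz Dz (rotc z)); exact: (v5 _ Drz).
- move=> z Dz; have Drz : polydisk R n (rotate c z) by rewrite Drot.
  by rewrite -(tor1 _ _ Drz Dz (rotc z)); exact: (v6 _ Drz).
Qed.

(** The geodesic composed with the rotation taking [z] to [w] is a subgeodesic, so maximality
    applies. Where [z_j = 0], also [w_j = 0] and any unimodular factor serves. *)
Lemma geodesic_toric_le (u0 u1 : 'rV[Cx R]_n -> \bar R)
    (u : R -> 'rV[Cx R]_n -> \bar R) t z w :
  toric u0 -> toric u1 -> geodesic u0 u1 u ->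
  0 < t < 1 -> polydisk R n z -> (forall j, cabs (z ord0 j) = cabs (w ord0 j)) ->
  (u t w <= u t z)%E.
Proof.
move=> tor0 tor1 [su mu] t01 Dz zw.
pose c j := if z ord0 j == 0 then 1 else w ord0 j / z ord0 j.
have c1 j : cabs (c j) = 1.
  rewrite /c; case: ifPn => [_|z0]; first exact: cabs1.
  by rewrite cabsM cabsV -zw mulfV// cabs_eq0.
have cz : rotate c z = w.
  apply/rowP => j; rewrite mxE /c; case: ifPn => [z0|z0]; last by rewrite divfK.
  have : w ord0 j == 0 by rewrite -cabs_eq0 -zw cabs_eq0.
  by rewrite (eqP z0) mul1r => /eqP ->.
rewrite -cz.
exact: (mu _ (rotate_subgeodesic tor0 tor1 c1 su) t z t01 Dz).
Qed.

Lemma cabs_expR (y : R) : cabs (((expR y)%:C)%C : Cx R) = expR y.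
Proof. by rewrite cabsR gtr0_norm ?expR_gt0. Qed.

Definition rexp (s : 'I_n -> R) : 'rV[Cx R]_n := \row_j ((expR (s j))%:C)%C.

Lemma rexp_polydisk (s : 'I_n -> R) : (forall j, s j < 0) -> polydisk R n (rexp s).
Proof. by move=> s0 j; rewrite mxE cabs_expR expR_lt1. Qed.

(* Logarithmic coordinates: [Some j] stands for [ln |z_j|], [None] for [ln |zeta|]. *)
Definition explog (x : option 'I_n -> R) : 'rV[Cx R]_n := rexp (fun j => x (Some j)).

Definition logdom (x : option 'I_n -> R) : Prop :=
  (forall j, x (Some j) < 0) /\ 0 < x None < 1.

Lemma explog_dom x : logdom x ->
  (polydisk R n `*` annulus R) (explog x, ((expR (x None))%:C)%C).
Proof.
move=> [xn /andP[x0 x1]]; split=> /=; first exact: rexp_polydisk.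
by rewrite /annulus/= cabs_expR -{1}(@expR0 R) !ltr_expR x0 x1.
Qed.

Lemma geodesic_log_submean (u0 u1 : 'rV[Cx R]_n -> \bar R)
    (u : R -> 'rV[Cx R]_n -> \bar R) (x d : option 'I_n -> R) (h : R -> R) :
  toric u0 -> toric u1 -> geodesic u0 u1 u ->
  (forall j, `|d j| <= 4^-1) ->
  (forall z : option 'I_n -> R, (forall j, `|z j - x j| <= 3 * `|d j|) -> logdom z) ->
  continuous h ->
  (forall t, (u (x None + logcirc (d None) t)%R
                (explog (fun j => x j + logcirc (d j) t)%R) <= (h t)%:E)%E) ->
  (u (x None) (explog x) <= (cmean h)%:E)%E.
Proof.
move=> tor0 tor1 gu d4 dom ch uh.
have [[[_ _ v3] _ _ _] _] := gu.
pose a : 'rV[Cx R]_n * Cx R := (explog x, ((expR (x None))%:C)%C).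
pose b : 'rV[Cx R]_n * Cx R :=
  (\row_j ((expR (x (Some j)) * d (Some j))%:C)%C, ((expR (x None) * d None)%:C)%C).
pose zt (tau : Cx R) j := x j + ln (cabs (1 + ((d j)%:C)%C * tau)).
have small tau j : cabs tau <= 1 -> cabs (((d j)%:C)%C * tau) <= `|d j|.
  by move=> t1; rewrite cabsM cabsR ler_piMr.
have pos tau j : cabs tau <= 1 -> 0 < cabs (1 + ((d j)%:C)%C * tau).
  move=> t1; rewrite cabs_gt0 addr_eq0; apply/eqP => E.
  have := le_trans (small tau j t1) (d4 j).
  by rewrite -cabsN -E cabs1; lra.
(* The submean inequality requires the whole closed disc, not only its boundary circle, to lie in
   the domain. *)
have ztdom tau : cabs tau <= 1 -> logdom (zt tau).
  move=> t1; apply: dom => j; rewrite /zt addrC addKr.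
  apply: (le_trans (ln_cabs1D (le_trans (small tau j t1) (d4 j)))).
  by rewrite ler_pM2l// small.
have cfst tau j : cabs tau <= 1 -> cabs ((a + tau *: b).1 ord0 j) = expR (zt tau (Some j)).
  move=> t1; rewrite /zt expRD lnK ?posrE ?pos// -cabs_expR -cabsM !mxE.
  by rewrite rmorphM/=; congr cabs; ring.
have csnd tau : cabs tau <= 1 -> cabs ((a + tau *: b).2) = expR (zt tau None).
  move=> t1; rewrite /zt expRD lnK ?posrE ?pos// -cabs_expR -cabsM.
  by rewrite /a /b /= rmorphM/=; congr cabs; rewrite /GRing.scale/=; ring.
have [_ _ /(_ 0 1 ltr01)] := v3 a b.
rewrite scale0r addr0 /a /= cabs_expR expRK => /(_ _)/wrap[].
  move=> tau; rewrite subr0 => t1; have [z1 /andP[z2 z3]] := ztdom tau t1; split.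
    by move=> j; rewrite cfst// expR_lt1.
  by rewrite /annulus/= csnd// -{1}(@expR0 R) !ltr_expR z2 z3.
move=> /le_trans; apply; apply: circle_mean_le ch _ => t.
rewrite -/a.
have -> : 0 + (1%:C)%C * cis t = cis t :> Cx R by rewrite add0r mul1r.
have c1 : cabs (cis t : Cx R) <= 1 by rewrite cabs_cis.
change (u (ln (cabs (a + cis t *: b)%R.2)) (a + cis t *: b)%R.1 <= (h t)%:E)%E.
rewrite csnd// expRK.
have [z1 z2] := ztdom _ c1.
apply: (le_trans _ (uh t)).
apply: (geodesic_toric_le tor0 tor1 gu) => //; first exact: (rexp_polydisk z1).
by move=> j; rewrite cfst// mxE cabs_expR.
Qed.

Lemma geodesic_log_convex (u0 u1 : 'rV[Cx R]_n -> \bar R)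
    (u : R -> 'rV[Cx R]_n -> \bar R) p q (l A B : R) :
  toric u0 -> toric u1 -> geodesic u0 u1 u ->
  logdom p -> logdom q -> 0 < l < 1 ->
  (u (p None) (explog p) < A%:E)%E -> (u (q None) (explog q) < B%:E)%E ->
  (u ((1 - l) * p None + l * q None)%R
     (explog (fun j => (1 - l) * p j + l * q j)%R) <= ((1 - l) * A + l * B)%:E)%E.
Proof.
move=> tor0 tor1 gu pd qd l01 pA qB.
have [[[_ v2 _] v4 _ _] _] := gu.
apply: (@log_submean_convex R (option 'I_n : finType) logdom
          (fun x => u (x None) (explog x))) l01 pA qB => //.
- move=> x z k [p1 /andP[p2 p3]] [q1 /andP[q2 q3]] k01.
  split=> [j|]; first exact: convex_comb_lt.
  rewrite convex_comb_lt// andbT -oppr_lt0 opprD -!mulrN.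
  by rewrite convex_comb_lt// oppr_lt0.
- move=> x [x1 /andP[x2 x3]].
  have [r1 r10 hr1] : exists2 r : R, 0 < r & forall j, x (Some j) + r < 0.
    exists (\big[Num.min/1]_j (- x (Some j) / 2)).
      by apply: lt_bigmin => // j _; rewrite divr_gt0// oppr_gt0.
    move=> j; have : \big[Num.min/1]_j (- x (Some j) / 2) <= - x (Some j) / 2.
      exact: bigmin_le_cond.
    by have := x1 j; lra.
  exists (Num.min r1 (Num.min (x None) (1 - x None))).
    by rewrite !lt_min r10 x2 subr_gt0.
  move=> z zx; split=> [j|].
    have := zx (Some j); rewrite !lt_min => /andP[+ _].
    by rewrite ltr_norml => /andP[_]; have := hr1 j; lra.
  have := zx None; rewrite !lt_min !ltr_norml => /and3P[_ /andP[z1 z2] /andP[z3 z4]].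
  by apply/andP; split; lra.
- move=> x xd; have := v4 _ (explog_dom xd).
  by rewrite /= cabs_expR expRK.
- move=> x a xd xa.
  have /= h := v2 _ (explog_dom xd) a.
  rewrite cabs_expR expRK in h.
  have /nbhs_prodCxP[e e0 he] := h xa.
  exists (e / expR 1); first by rewrite divr_gt0// expR_gt0.
  move=> z zd zx.
  have bnd j : cabs ((((expR (x j))%:C)%C - ((expR (z j))%:C)%C) : Cx R) < e.
    rewrite -rmorphB cabsR.
    have le1 y : logdom y -> y j <= 1.
      by move=> [y1 /andP[_ y3]]; case: j {zx} => [j|]; [have := y1 j|]; lra.
    apply: (le_lt_trans (expR_lip (le1 z zd) (le1 x xd))).
    by rewrite mulrC -ltr_pdivlMr ?expR_gt0.
  have := he (explog z) ((expR (z None))%:C)%C.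
  rewrite /= cabs_expR expRK; apply => //; last exact: explog_dom.
  by move=> j; rewrite !mxE.
- move=> x d h xd d4 dom ch uh.
  exact: (geodesic_log_submean tor0 tor1 gu d4 dom ch uh).
Qed.

End GeodesicConvex.

(** * Subgeodesics defined by linear functions *)

Section RegularizedLog.
Context {R : realType}.
Implicit Types (a b w : Cx R) (e x : R).

(** Logarithm of the norm of (w, sqrt e) in C^2: a continuous function decreasing to ln |w| as e
    decreases to 0. *)
Definition lnreg e w : R := ln (cabs w ^+ 2 + e) / 2.

Lemma lnreg_gt0 e w : 0 < e -> 0 < cabs w ^+ 2 + e.
Proof. by move=> e0; rewrite ltr_wpDl// sqr_ge0. Qed.

Lemma continuous_lnreg e : 0 < e -> continuous (lnreg e).
Proof.
move=> e0 w.
apply: (@cvgM R _ (nbhs w) _ (fun w => ln (cabs w ^+ 2 + e)) (fun=> 2^-1)); last exact: cvg_cst.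
apply: (@continuous_comp _ _ _ (fun w => cabs w ^+ 2 + e) (@ln R)); last first.
  by apply: continuous_ln; exact: lnreg_gt0.
apply: (@cvgD R R _ (nbhs w) _ (fun w => cabs w ^+ 2) (fun=> e)); last exact: cvg_cst.
by apply: (@cvgM R _ (nbhs w) _ (@cabs R) (@cabs R)); exact: continuous_cabs.
Qed.

Lemma continuous_lnreg_circle e a b : 0 < e ->
  continuous (fun x => lnreg e (a + b * cis x)).
Proof.
move=> e0 x; apply: (@continuous_comp _ _ _ (fun x => a + b * cis x) (lnreg e)).
  exact: continuous_circle.
exact: continuous_lnreg.
Qed.

Lemma cabs_conj w : cabs ((w^*)%C : Cx R) = cabs w.
Proof. by case: w => w1 w2; rewrite !cabsE/= sqrrN. Qed.

(* Cauchy-Schwarz for the unit vector (a, sqrt e) / N of C^2. *)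
Lemma cabs_tangent e a w (N : R) : 0 <= e -> 0 < N -> N ^+ 2 = cabs a ^+ 2 + e ->
  cabs ((N%:C)%C + ((N^-1)%:C)%C * (a^*)%C * w : Cx R) ^+ 2 <= cabs (a + w) ^+ 2 + e.
Proof.
case: a w => [a1 a2] [w1 w2] e0 N0; rewrite !cabs_sqr /=.
set M := N^-1; have NM : N * M = 1 by rewrite mulfV// gt_eqF.
move=> NE.
rewrite !mul0r !subr0 !addr0 !add0r.
have -> : (N + (M * a1 * w1 - M * - a2 * w2)) ^+ 2 + (M * a1 * w2 + M * - a2 * w1) ^+ 2 =
  N ^+ 2 + 2 * (N * M) * (a1 * w1 + a2 * w2) + M ^+ 2 * (a1 ^+ 2 + a2 ^+ 2) * (w1 ^+ 2 + w2 ^+ 2).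
  by ring.
rewrite NM.
have h : M ^+ 2 * (a1 ^+ 2 + a2 ^+ 2) <= (N * M) ^+ 2.
  by rewrite exprMn mulrC ler_wpM2r ?sqr_ge0// NE lerDl.
have : M ^+ 2 * (a1 ^+ 2 + a2 ^+ 2) * (w1 ^+ 2 + w2 ^+ 2) <= 1 * (w1 ^+ 2 + w2 ^+ 2).
  by rewrite ler_wpM2r ?addr_ge0 ?sqr_ge0//; move: h; rewrite NM expr1n.
rewrite NE; clear; lra.
Qed.

(** With N = sqrt (|a|^2 + e), the function ln |N + N^-1 conj(a) w| touches [lnreg e (a + w)] from
    below at w = 0. The hypothesis says that its argument has no zero in the disc |w| <= |b|, so it
    equals its own mean. *)
Lemma lnreg_submean_aux e a b : 0 < e -> cabs a * cabs b < cabs a ^+ 2 + e ->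
  lnreg e a <= cmean (fun x => lnreg e (a + b * cis x)).
Proof.
move=> e0 ab; pose N := Num.sqrt (cabs a ^+ 2 + e).
have N0 : 0 < N by rewrite sqrtr_gt0 lnreg_gt0.
have N2 : N ^+ 2 = cabs a ^+ 2 + e by rewrite sqr_sqrtr// ltW// lnreg_gt0.
pose m : Cx R := ((N^-1)%:C)%C * (a^*)%C * b.
have cN : cabs ((N%:C)%C : Cx R) = N by rewrite cabsR gtr0_norm.
have mN : cabs m < cabs ((N%:C)%C : Cx R).
  rewrite cN /m !cabsM cabs_conj cabsR gtr0_norm ?invr_gt0// -mulrA.
  by rewrite mulrC ltr_pdivrMr// -expr2 N2.
have -> : lnreg e a = ln (cabs ((N%:C)%C : Cx R)).
  by rewrite /lnreg -N2 lnXn// cN -[ln N *+ 2]mulr_natr mulfK.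
rewrite -(cmean_ln_circle mN); apply: cmean_le.
- exact: continuous_ln_circle.
- exact: continuous_lnreg_circle.
move=> x; rewrite /lnreg ler_pdivlMr// mulr_natr -lnXn ?cabs_gt0 ?circle_neq0//.
rewrite ler_ln ?posrE ?lnreg_gt0//; last by rewrite exprn_gt0// cabs_gt0 circle_neq0.
by have := cabs_tangent (b * cis x) (ltW e0) N0 N2; rewrite /m !mulrA.
Qed.

(** When the touching function has a zero in the disc, |a| < |b|. Since |a + b e^(i x)| = |conj(b) +
    conj(a) e^(i x)|, the two coefficients can be exchanged, which only raises the central value. *)
Lemma lnreg_submean e a b : 0 < e ->
  lnreg e a <= cmean (fun x => lnreg e (a + b * cis x)).
Proof.
move=> e0; have [ab|ab] := ltP (cabs a * cabs b) (cabs a ^+ 2 + e).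
  exact: lnreg_submean_aux.
have a0 := cabs_ge0 a; have b0 := cabs_ge0 b.
have lab : cabs a < cabs b by rewrite ltNge; apply/negP => ba; nra.
have ba : cabs ((b^*)%C : Cx R) * cabs ((a^*)%C : Cx R) < cabs ((b^*)%C : Cx R) ^+ 2 + e.
  by rewrite !cabs_conj; nra.
apply: (@le_trans _ _ (lnreg e ((b^*)%C : Cx R))).
  rewrite /lnreg cabs_conj ler_pM2r ?invr_gt0// ler_ln ?posrE ?lnreg_gt0// lerD2r.
  by rewrite lerXn2r// ?nnegrE// ltW.
apply: (le_trans (lnreg_submean_aux e0 ba)); rewrite le_eqVlt; apply/orP; left; apply/eqP.
congr cmean; apply/funext => x; rewrite /lnreg; congr (ln (_ + _) / _).
have cs := cos2Dsin2 x; move: a b {ab a0 b0 lab ba} => [a1 a2] [b1 b2].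
rewrite !cabs_sqr /= /cis /=.
transitivity ((b1 ^+ 2 + b2 ^+ 2) + (a1 ^+ 2 + a2 ^+ 2) * (cos x ^+ 2 + sin x ^+ 2)
  + 2 * (b1 * (a1 * cos x + a2 * sin x) - b2 * (a1 * sin x - a2 * cos x))); first by ring.
transitivity ((a1 ^+ 2 + a2 ^+ 2) + (b1 ^+ 2 + b2 ^+ 2) * (cos x ^+ 2 + sin x ^+ 2)
  + 2 * (b1 * (a1 * cos x + a2 * sin x) - b2 * (a1 * sin x - a2 * cos x))); last by ring.
by rewrite cs; ring.
Qed.

End RegularizedLog.

Lemma lee_above (R : realType) (x z : \bar R) :
  (forall a : R, (x < a%:E)%E -> (z <= a%:E)%E) -> (z <= x)%E.
Proof.
case: x => [x| |] h; last 2 first.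
- by rewrite leey.
- case: z h => [z|h|//]; last by have := h 0%R (ltNyr _).
  by move=> h; have := h (z - 1)%R (ltNyr _); rewrite lee_fin leNgt ltrBlDl ltrDr ltr01.
apply/lee_addgt0Pr => e e0; rewrite -EFinD; apply: h.
by rewrite lte_fin ltrDl.
Qed.

Lemma plurisubharmonic_intro (R : realType) (V : normedModType (Cx R)) (D : set V)
    (u : V -> \bar R) :
  (forall x, D x -> (u x < +oo)%E) -> usc_on D u ->
  (forall (a b : V) (c : Cx R) (r : R), 0 < r ->
     (forall x : Cx R, cabs (x - c) <= r -> D (a + x *: b)) ->
     (u (a + c *: b)%R <= circle_mean (fun tau => u (a + tau *: b)%R) c r)%E) ->
  plurisubharmonic D u.
Proof.
move=> fin usc sub; split=> // a b; split; [|move=> tau /= Dtau e ue|exact: sub].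
  by move=> x /= Dx; exact: fin.
have cont : {for tau, continuous (fun tau : Cx R => a + tau *: b)}.
  apply: (@cvgD _ _ _ (nbhs tau)); first exact: cvg_cst.
  by apply: (@cvgZr_tmp _ _ _ (nbhs tau)); exact: cvg_id.
exact: (cont _ (usc _ Dtau _ ue)).
Qed.

(** * The candidate subgeodesic as a decreasing limit *)

Section Candidate.
Context {R : realType} {n : nat}.
Variables (y : 'I_n -> R) (A B : R).
Hypothesis y0 : forall j, 0 <= y j.

Definition harm (k : nat) : R := (k.+1%:R)^-1.

Lemma harm_gt0 k : 0 < harm k.
Proof. by rewrite invr_gt0. Qed.

Lemma harm_small (e : R) : 0 < e -> exists k, harm k < e.
Proof.
move=> e0; exists (Num.truncn e^-1).
have i0 : 0 < e^-1 by rewrite invr_gt0.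
rewrite /harm -[ltRHS]invrK ltf_pV2 ?posrE//.
by have /andP[] := truncn_itv (ltW i0).
Qed.

Definition reglog (k : nat) (z : 'rV[Cx R]_n) : R :=
  \sum_j y j * lnreg (harm k) (z ord0 j).

(* The regularisation of [sum_j y_j ln |z_j| - ((1 - t) A + t B)]; the infimum is
   its value, namely -oo where [z_j = 0] for some [j] with [y_j > 0]. *)
Definition candidate (t : R) (z : 'rV[Cx R]_n) : \bar R :=
  ereal_inf [set (reglog k z - ((1 - t) * A + t * B))%:E | k in [set: nat]].

Lemma reglog_nonincr k z : reglog k.+1 z <= reglog k z.
Proof.
apply: ler_sum => j _; rewrite ler_wpM2l// ler_pM2r ?invr_gt0//.
rewrite ler_ln ?posrE ?lnreg_gt0 ?harm_gt0// lerD2l lef_pV2 ?posrE//.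
by rewrite ler_nat.
Qed.

Lemma candidate_le k t z : (candidate t z <= (reglog k z - ((1 - t) * A + t * B))%:E)%E.
Proof. by apply: ereal_inf_lbound; exists k. Qed.

Lemma candidate_explog t (s : 'rV[R]_n) :
  ((\sum_j y j * s ord0 j - ((1 - t) * A + t * B))%:E <=
   candidate t (\row_j ((expR (s ord0 j))%:C)%C))%E.
Proof.
apply: le_ereal_inf_tmp => _ [k _ <-]; rewrite lee_fin lerD2r.
apply: ler_sum => j _; rewrite ler_wpM2l// mxE /lnreg cabsR.
rewrite (gtr0_norm (expR_gt0 _)) ler_pdivlMr// -[leLHS]expRK mulr_natr.
rewrite ler_ln ?posrE ?expR_gt0 ?addr_gt0 ?exprn_gt0 ?expR_gt0 ?harm_gt0//.
by rewrite mulr2n expRD -expr2 lerDl ltW// harm_gt0.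
Qed.

Lemma candidate_plurisubharmonic :
  plurisubharmonic (polydisk R n `*` annulus R)
    (fun p => candidate (ln (cabs p.2)) p.1).
Proof.
apply: plurisubharmonic_intro.
- move=> p _; apply: (le_lt_trans (candidate_le 0 _ _)); exact: ltry.
- move=> [z zeta] [/= Dz /andP[z1 z2]] a /ereal_inf_lt[_ [k _ <-]]; rewrite lte_fin => ka.
  pose G (p : 'rV[Cx R]_n * Cx R) :=
    reglog k p.1 - ((1 - ln (cabs p.2)) * A + ln (cabs p.2) * B).
  pose F := nbhs (z, zeta).
  have c2 : cabs p.2 @[p --> F] --> cabs zeta.
    apply: (@continuous_cvg _ _ _ F _ snd (@cabs R) zeta); first exact: continuous_cabs.
    exact: cvg_snd.
  have cl : ln (cabs p.2) @[p --> F] --> ln (cabs zeta).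
    apply: (@continuous_cvg _ _ _ F _ (fun p => cabs p.2) (@ln R) (cabs zeta)) c2.
    by apply: continuous_ln; apply: lt_trans z1.
  have cr : continuous (fun p : 'rV[Cx R]_n * Cx R => reglog k p.1).
    apply: continuous_sumr => j p.
    apply: (@cvgM R _ (nbhs p) _ (fun=> y j) (fun p => lnreg (harm k) (p.1 ord0 j))).
      exact: cvg_cst.
    apply: (@continuous_cvg _ _ _ (nbhs p) _
              (fun p => p.1 ord0 j) (lnreg (harm k)) (p.1 ord0 j)).
      exact/continuous_lnreg/harm_gt0.
    apply: (@continuous_cvg _ _ _ (nbhs p) _ fst (fun w : 'rV[Cx R]_n => w ord0 j) p.1).
      exact: coord_continuous.
    exact: cvg_fst.
  have cG : G p @[p --> F] --> G (z, zeta).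
    apply: (@cvgB R R _ F _ (fun p => reglog k p.1)
      (fun p => (1 - ln (cabs p.2)) * A + ln (cabs p.2) * B)); first exact: cr.
    apply: (@cvgD R R _ F _ (fun p => (1 - ln (cabs p.2)) * A) (fun p => ln (cabs p.2) * B)).
      apply: (@cvgM R _ F _ (fun p => 1 - ln (cabs p.2)) (fun=> A)); last exact: cvg_cst.
      by apply: (@cvgB R R _ F _ (fun=> 1) (fun p => ln (cabs p.2))); [exact: cvg_cst|exact: cl].
    by apply: (@cvgM R _ F _ (fun p => ln (cabs p.2)) (fun=> B)); [exact: cl|exact: cvg_cst].
  have /(cvgr_lt (G (z, zeta)))/(_ _ ka) := cG.
  apply: filterS => p Gp _.
  by apply: (le_lt_trans (candidate_le k _ _)); rewrite lte_fin.
move=> [a1 a2] [b1 b2] c r r0 disc.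
pose al j := a1 ord0 j + c * b1 ord0 j; pose be j := (r%:C)%C * b1 ord0 j.
pose al' := a2 + c * b2; pose be' := (r%:C)%C * b2.
(* Otherwise the second coordinate would vanish at [- a2 / b2], inside the disc, although the
   annulus omits 0. *)
have ba : cabs be' < cabs al'.
  rewrite ltNge; apply/negP => h.
  have alp : 0 < cabs al'.
    have [_ /andP[+ _]] := disc c (ltac:(by rewrite subrr cabs0 ltW)).
    exact: lt_trans.
  have b20 : b2 != 0.
    by apply: contraTneq (lt_le_trans alp h) => b20; rewrite /be' b20 mulr0 cabs0 ltxx.
  have [|_ /andP[+ _]] := disc (- a2 / b2).
    have -> : - a2 / b2 - c = - (al' / b2) by rewrite /al'; field.
    rewrite cabsN cabsM cabsV ler_pdivrMr ?cabs_gt0//.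
    by rewrite (le_trans h)// /be' cabsM cabsR (gtr0_norm r0).
  rewrite /= /GRing.scale/= divfK// subrr cabs0.
  by rewrite ltNge ler01.
pose h k x := reglog k (a1 + (c + (r%:C)%C * cis x) *: b1) -
  ((1 - ln (cabs (al' + be' * cis x))) * A + ln (cabs (al' + be' * cis x)) * B).
pose reg k j x := lnreg (harm k) (al j + be j * cis x).
(* Isolates ln |zeta| with its coefficient [A - B] of unknown sign; its mean is computed exactly,
   while the [reg] terms, weighted by [y j >= 0], need only an inequality. *)
have hE k : h k = fun x => (\sum_j y j * reg k j x - A) + (A - B) * ln (cabs (al' + be' * cis x)).
  apply/funext => x; rewrite /h.
  have -> : reglog k (a1 + (c + (r%:C)%C * cis x) *: b1) = \sum_j y j * reg k j x.
    apply: eq_bigr => j _; congr (_ * lnreg _ _).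
    by rewrite !mxE /al /be; ring.
  by ring.
have creg k j : continuous (reg k j) by apply: continuous_lnreg_circle; exact: harm_gt0.
have cyreg k j : continuous (fun x => y j * reg k j x).
  by move=> x; apply: cvgM; [exact: cvg_cst|exact: creg].
have csum k : continuous (fun x => \sum_j y j * reg k j x) by exact: continuous_sumr.
have cA : continuous (fun _ : R => A) by move=> x; exact: cvg_cst.
have csA k : continuous (fun x => \sum_j y j * reg k j x - A).
  by move=> x; apply: cvgB; [exact: csum|exact: cA].
have cln := continuous_ln_circle ba.
have cABln : continuous (fun x => (A - B) * ln (cabs (al' + be' * cis x))).
  by move=> x; apply: cvgM; [exact: cvg_cst|exact: cln].
have ch k : continuous (h k).
  by rewrite hE => x; apply: cvgD; [exact: csA|exact: cABln].
have mh k : reglog k (a1 + c *: b1) - ((1 - ln (cabs al')) * A + ln (cabs al') * B) <= cmean (h k).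
  rewrite hE (cmeanD (csA k) cABln) (cmeanB (csum k) cA) cmean_cst (cmeanZ _ cln).
  rewrite (cmean_ln_circle ba).
  have -> : reglog k (a1 + c *: b1) - ((1 - ln (cabs al')) * A + ln (cabs al') * B) =
    reglog k (a1 + c *: b1) - A + (A - B) * ln (cabs al') by ring.
  rewrite !lerD2r (cmean_sum _ (cyreg k)); apply: ler_sum => j _.
  rewrite (cmeanZ _ (creg k j)) ler_wpM2l//.
  by rewrite !mxE; exact/lnreg_submean/harm_gt0.
have fE x : candidate (ln (cabs ((a1, a2) + (c + (r%:C)%C * cis x) *: (b1, b2)).2))
    ((a1, a2) + (c + (r%:C)%C * cis x) *: (b1, b2)).1 =
    ereal_inf [set (h k x)%:E | k in [set: nat]].
  congr ereal_inf; apply: eq_imagel => k _; rewrite /h /=.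
  have -> : a2 + (c + (r%:C)%C * cis x) *: b2 = al' + be' * cis x.
    by rewrite /al' /be' /GRing.scale/=; ring.
  by [].
change (candidate (ln (cabs al')) (a1 + c *: b1) <= circle_mean
  (fun tau => candidate (ln (cabs ((a1, a2) + tau *: (b1, b2))%R.2))
    ((a1, a2) + tau *: (b1, b2))%R.1) c r)%E.
have := fun k => candidate_le k (ln (cabs al')) (a1 + c *: b1).
case: (candidate (ln (cabs al')) _) => [g gle|/(_ 0%N)//|_]; last exact: leNye.
apply: (circle_mean_inf ch) fE.
- by move=> k x; rewrite /h lerD2r reglog_nonincr.
- by move=> k; apply: le_trans (mh k); rewrite -lee_fin.
Qed.

End Candidate.

Lemma small_mul_le (R : realType) (l c g : R) : `|l| < g / (1 + `|c|) -> - (l * c) <= g.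
Proof.
rewrite ltr_pdivlMr ?ltr_pwDl// mulrDr mulr1 -normrM => h.
have := ler_norm (- (l * c)); rewrite normrN.
have := normr_ge0 l; lra.
Qed.

(** * Boundary behaviour of candidates and signs of the Legendre data *)

Section Boundary.
Context {R : realType} {n : nat}.
Implicit Types (z : 'rV[Cx R]_n) (u : 'rV[Cx R]_n -> \bar R).

Lemma polydisk_margin z : polydisk R n z ->
  exists2 m : R, 0 < m & forall j, cabs (z ord0 j) ^+ 2 + m <= 1.
Proof.
move=> Dz; exists (\big[Num.min/1]_j (1 - cabs (z ord0 j) ^+ 2)).
  apply: lt_bigmin => // j _; rewrite subr_gt0.
  have := cabs_ge0 (z ord0 j); have := Dz j; nra.
by move=> j; rewrite addrC -lerBrDr; exact: bigmin_le_cond.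
Qed.

(** [reglog y k z] is the linear form [y] at s_j = ln sqrt (|z_j|^2 + harm k), a finite point even
    where z_j = 0. For large [k] it lies in the negative orthant and [rexp s] is close to (|z_j|),
    so the bound on [u] at [z] passes to [rexp s] by torality and semicontinuity. *)
Lemma reglog_le_bound u (y : 'I_n -> R) (C : R) z (a : R) :
  usc_on (polydisk R n) u -> toric u ->
  (forall s : 'I_n -> R, (forall j, s j < 0) ->
     ((\sum_j s j * y j)%:E <= C%:E + u (rexp s))%E) ->
  polydisk R n z -> (u z < a%:E)%E ->
  exists k, reglog y k z <= C + a.
Proof.
move=> usc tor hC Dz uza; have [m m0 hm] := polydisk_margin Dz.
pose z' : 'rV[Cx R]_n := \row_j ((cabs (z ord0 j))%:C)%C.
have zz' j : cabs (z' ord0 j) = cabs (z ord0 j).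
  by rewrite mxE cabsR ger0_norm// cabs_ge0.
have Dz' : polydisk R n z' by move=> j; rewrite zz'.
rewrite (tor z z') // in uza.
have /nbhs_rVCxP[e e0 he] := usc z' Dz' a uza.
(* Below [m], so that s_j < 0; below e^2, because sqrt (r^2 + h) - r <= sqrt h. *)
have [k] : exists k, @harm R k < Num.min m (e ^+ 2).
  by apply: harm_small; rewrite lt_min m0 exprn_gt0.
rewrite lt_min => /andP[km ke]; exists k.
have k0 := @harm_gt0 R k.
pose s j := lnreg (@harm R k) (z ord0 j).
have sE j : expR (s j) ^+ 2 = cabs (z ord0 j) ^+ 2 + @harm R k.
  rewrite -expRM_natl /s /lnreg mulrC divfK// lnK// posrE lnreg_gt0//.
have s1 j : expR (s j) < 1.
  have := hm j; have := expR_gt0 (s j); have := sE j; nra.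
have s0 j : s j < 0 by rewrite -expR_lt1.
have uw : (u (rexp s) < a%:E)%E.
  apply: he; last exact: rexp_polydisk.
  move=> j; rewrite !mxE -rmorphB cabsR distrC.
  have cz := cabs_ge0 (z ord0 j).
  have ep := expR_gt0 (s j); have sEj := sE j.
  have le : cabs (z ord0 j) <= expR (s j) by nra.
  rewrite ger0_norm ?subr_ge0//; nra.
have := hC s s0; move: uw; case: (u (rexp s)) => [b| |] //.
rewrite lte_fin -EFinD lee_fin => ba hb.
have -> : reglog y k z = \sum_j s j * y j by apply: eq_bigr => j _; rewrite mulrC.
by apply: (le_trans hb); rewrite lerD2l ltW.
Qed.

Lemma candidate_subgeodesic u0 u1 (y : 'I_n -> R) (A B : R) :
  usc_on (polydisk R n) u0 -> usc_on (polydisk R n) u1 -> toric u0 -> toric u1 ->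
  (forall j, 0 <= y j) -> 0 <= A -> 0 <= B ->
  (forall s : 'I_n -> R, (forall j, s j < 0) ->
     ((\sum_j s j * y j)%:E <= A%:E + u0 (rexp s))%E) ->
  (forall s : 'I_n -> R, (forall j, s j < 0) ->
     ((\sum_j s j * y j)%:E <= B%:E + u1 (rexp s))%E) ->
  subgeodesic u0 u1 (candidate y A B).
Proof.
move=> usc0 usc1 tor0 tor1 y0 A0 B0 hA hB; split.
- exact: candidate_plurisubharmonic.
- move=> [z zeta] [/= Dz /andP[z1 z2]]; have [m m0 hm] := polydisk_margin Dz.
  have [k km] := harm_small m0.
  apply: (le_trans (candidate_le y A B k _ _)); rewrite lee_fin subr_le0.
  have l0 : 0 < ln (cabs zeta) by rewrite ln_gt0.
  have l1 : ln (cabs zeta) < 1.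
    by rewrite -(@expRK R 1) ltr_ln ?posrE ?expR_gt0 ?(lt_trans ltr01 z1).
  apply: (@le_trans _ _ 0).
    apply: sumr_le0 => j _; apply: mulr_ge0_le0 => //.
    rewrite /lnreg pmulr_lle0 ?invr_gt0// ln_le0//.
    by apply: le_trans (hm j); rewrite lerD2l ltW.
  by rewrite addr_ge0// mulr_ge0// ?subr_ge0 ltW.
- move=> z Dz; apply: lee_above => a /lte_between[b ub ba].
  have [k hk] := reglog_le_bound usc0 tor0 hA Dz ub.
  (* With l = ln |zeta|, the candidate is at most b - l (B - A); this radius keeps the last term
     below a - b, and the 1 in the denominator covers A = B. *)
  apply: ereal_inf_le; exists (ereal_sup ((fun zeta => candidate y A B (ln (cabs zeta)) z) @`
    [set zeta | annulus R zeta /\ `|ln (cabs zeta) - 0| < (a - b) / (1 + `|B - A|)])).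
    eexists; last by [].
    by exists ((a - b) / (1 + `|B - A|)) => //=; rewrite divr_gt0 ?subr_gt0 ?ltr_pwDl.
  apply: ge_ereal_sup => _ [zeta [_ hz] <-].
  apply: (le_trans (candidate_le y A B k _ _)); rewrite lee_fin.
  have := small_mul_le hz; lra.
- move=> z Dz; apply: lee_above => a /lte_between[b ub ba].
  have [k hk] := reglog_le_bound usc1 tor1 hB Dz ub.
  apply: ereal_inf_le; exists (ereal_sup ((fun zeta => candidate y A B (ln (cabs zeta)) z) @`
    [set zeta | annulus R zeta /\ `|ln (cabs zeta) - 1| < (a - b) / (1 + `|B - A|)])).
    eexists; last by [].
    by exists ((a - b) / (1 + `|B - A|)) => //=; rewrite divr_gt0 ?subr_gt0 ?ltr_pwDl.
  apply: ge_ereal_sup => _ [zeta [_ hz] <-].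
  apply: (le_trans (candidate_le y A B k _ _)); rewrite lee_fin.
  have := small_mul_le hz; lra.
Qed.

Lemma legendre_point_ge0 u (y : 'I_n -> R) (A : R) :
  (forall z, polydisk R n z -> (u z < +oo)%E) -> usc_on (polydisk R n) u ->
  (forall s : 'I_n -> R, (forall j, s j < 0) ->
     ((\sum_j s j * y j)%:E <= A%:E + u (rexp s))%E) ->
  forall j, 0 <= y j.
Proof.
move=> fin usc hA j; rewrite leNgt; apply/negP => yj.
pose z0 : 'rV[Cx R]_n := \row_i (if i == j then 0 else ((expR (-1))%:C)%C).
have Dz0 : polydisk R n z0.
  move=> i; rewrite mxE; case: ifP => _; first by rewrite cabs0.
  by rewrite cabs_expR expR_lt1 oppr_lt0.
have [a ua] : exists a : R, (u z0 < a%:E)%E.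
  move: (fin _ Dz0); case: (u z0) => [a _| |_]//.
    by exists (a + 1); rewrite lte_fin ltrDl.
  by exists 0; exact: ltNyr.
have /nbhs_rVCxP[e e0 he] := usc _ Dz0 a ua.
pose S := \sum_(i | i != j) y i.
(* Setting s_j = -N brings [rexp s] into the neighbourhood of [z0] where u < a, while a negative
   [y j] pushes the linear form beyond A + a. *)
have [N [N0 Ne NA]] : exists N : R, [/\ 0 < N, expR (- N) < e & A + a + S < N * - y j].
  have yj0 : 0 < - y j by rewrite oppr_gt0.
  exists (1 + `|ln e| + `|A + a + S| / - y j).
  have q0 : 0 <= `|A + a + S| / - y j by rewrite divr_ge0// ltW.
  have le0 := normr_ge0 (ln e).
  split; first lra.
    rewrite -[ltRHS](@lnK _ e) ?posrE// ltr_expR.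
    by have := ler_norm (- ln e); rewrite normrN; lra.
  rewrite mulrDl divfK ?gt_eqF//.
  have := ler_norm (A + a + S).
  have : 0 < (1 + `|ln e|) * - y j by rewrite mulr_gt0// ltr_pwDl.
  lra.
pose s i := if i == j then - N else -1.
have s0 i : s i < 0 by rewrite /s; case: ifP => _; rewrite oppr_lt0.
have us : (u (rexp s) < a%:E)%E.
  apply: he; last exact: rexp_polydisk.
  move=> i; rewrite !mxE /s; case: ifP => _; last by rewrite subrr cabs0.
  by rewrite sub0r cabsN cabs_expR.
have := hA s s0; move: us; case: (u (rexp s)) => [b| |]//.
rewrite lte_fin -EFinD lee_fin (bigD1 j)//= {1}/s eqxx.
have -> : \sum_(i | i != j) s i * y i = - S.
  by rewrite /S -sumrN; apply: eq_bigr => i /negPf ij; rewrite /s ij mulN1r.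
lra.
Qed.

(** Along s = (-h, ..., -h) with h -> 0 the linear form tends to 0, and so does [u], because
    [rexp s] approaches the corner (1, ..., 1). This corner is a boundary point as soon as there is
    a coordinate. *)
Lemma legendre_value_ge0 u (y : 'I_n -> R) (A : R) : (0 < n)%N ->
  zero_boundary_values u ->
  (forall s : 'I_n -> R, (forall j, s j < 0) ->
     ((\sum_j s j * y j)%:E <= A%:E + u (rexp s))%E) ->
  0 <= A.
Proof.
move=> n0 bdry hA; rewrite leNgt; apply/negP => A0.
pose p : 'rV[Cx R]_n := const_mx 1.
have close (e : R) : 0 < e -> exists2 h0 : R, 0 < h0 &
    forall h : R, 0 < h -> h < h0 -> forall j, cabs (p ord0 j - rexp (fun=> - h) ord0 j) < e.
  move=> e0; exists e => // h h0 he j.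
  rewrite !mxE (_ : 1 = (1%:C)%C)// -rmorphB cabsR.
  have := expR_ge1Dx (- h); have : expR (- h) < 1 by rewrite expR_lt1 oppr_lt0.
  by move=> e1 e2; rewrite ger0_norm ?subr_ge0 ?ltW//; lra.
have pD : (closure (polydisk R n) `\` polydisk R n) p.
  split.
    move=> P /nbhs_rVCxP[e e0 eP]; have [h0 h00 hh] := close e e0.
    exists (rexp (fun=> - (h0 / 2))); split.
      by apply: rexp_polydisk => j; rewrite oppr_lt0 divr_gt0.
    by apply: eP => j; apply: hh; lra.
  by move=> /(_ (Ordinal n0)); rewrite mxE cabs1 ltxx.
pose d := - A / 2; have d0 : 0 < d by rewrite /d; lra.
have /nbhs_rVCxP[e e0 he] : \forall z \near within (polydisk R n) (nbhs p), (u z < d%:E)%E.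
  exact: (bdry p pD _ (@nbhs_open_ereal_lt R 0 (fun=> d) d0)).
have [h0 h00 hh] := close e e0.
pose S : R := `|\sum_j y j|; have S0 : 0 <= S by exact: normr_ge0.
have S1 : 0 < 1 + S by rewrite ltr_pwDl.
have [h [hp hh0 hS]] : exists h : R, [/\ 0 < h, h < h0 & h * S < d].
  exists (Num.min (h0 / 2) (d / 2 / (1 + S))).
  have q0 : 0 < d / 2 / (1 + S) by rewrite divr_gt0// divr_gt0.
  split; first by rewrite lt_min q0 divr_gt0.
    by rewrite gt_min; apply/orP; left; lra.
  have : Num.min (h0 / 2) (d / 2 / (1 + S)) <= d / 2 / (1 + S) by rewrite ge_min lexx orbT.
  move: (Num.min _ _) => h; rewrite ler_pdivlMr// mulrDr mulr1.
  by have [hn|hn] := leP h 0; [nra|lra].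
have s0 (j : 'I_n) : - h < 0 by rewrite oppr_lt0.
have us : (u (rexp (fun _ : 'I_n => - h)%R) < d%:E)%E.
  by apply: he; [exact: hh|exact: rexp_polydisk].
have := hA (fun=> - h) s0; move: us; case: (u _) => [b| |]//.
rewrite lte_fin -EFinD lee_fin -big_distrr/= => bd.
move: (ler_norm (\sum_j y j)) bd hS hp; rewrite -/S /d; clear; nra.
Qed.

End Boundary.

(** * Comparison of the geodesic with the Legendre transform *)

Lemma adherent_below (R : realType) (n : nat) (v : R -> 'rV[Cx R]_n -> \bar R)
    (z : 'rV[Cx R]_n) (c : R) (x : \bar R) :
  (limf_esup (fun zeta => v (ln (cabs zeta)) z) (@log_cabs_to R c) < x)%E ->
  exists2 e : R, 0 < e & forall t, 0 < t < 1 -> `|t - c| < e -> (v t z < x)%E.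
Proof.
move=> /ereal_inf_lt[_ [V [e /= e0 eV] <-]] hV; exists e => // t /andP[t0 t1] te.
apply: le_lt_trans hV; apply: ereal_sup_ubound.
have lt : ln (cabs (((expR t)%:C)%C : Cx R)) = t by rewrite cabs_expR expRK.
exists ((expR t)%:C)%C; last by rewrite lt.
apply: eV; split; last by rewrite lt.
by rewrite /annulus/= cabs_expR -{1}(@expR0 R) !ltr_expR t0 t1.
Qed.

(** * Interpolation and support of the geodesic *)

Section Interpolation.
Context {R : realType} {n : nat}.
Variables (u0 u1 : 'rV[Cx R]_n -> \bar R) (u : R -> 'rV[Cx R]_n -> \bar R).
Hypotheses (tor0 : toric u0) (tor1 : toric u1) (gu : geodesic u0 u1 u).
Implicit Types (s p q : 'I_n -> R).

Let point (s : 'I_n -> R) (t : R) (j : option 'I_n) : R :=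
  if j is Some i then s i else t.

Let point_dom s t : (forall j, s j < 0) -> 0 < t < 1 -> logdom (point s t).
Proof. by []. Qed.

Let convexU p q (tp tq l A B : R) : (forall j, p j < 0) -> (forall j, q j < 0) ->
  0 < tp < 1 -> 0 < tq < 1 -> 0 < l < 1 ->
  (u tp (rexp p) < A%:E)%E -> (u tq (rexp q) < B%:E)%E ->
  (u ((1 - l) * tp + l * tq)%R (rexp (fun j => (1 - l) * p j + l * q j)%R)
     <= ((1 - l) * A + l * B)%:E)%E.
Proof.
move=> p0 q0 tp01 tq01 l01 pA qB.
exact: (@geodesic_log_convex R n u0 u1 u (point p tp) (point q tq) l A B).
Qed.

Lemma geodesic_convex t p q (l A B : R) : 0 < t < 1 ->
  (forall j, p j < 0) -> (forall j, q j < 0) -> 0 < l < 1 ->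
  (u t (rexp p) < A%:E)%E -> (u t (rexp q) < B%:E)%E ->
  (u t (rexp (fun j => (1 - l) * p j + l * q j)%R) <= ((1 - l) * A + l * B)%:E)%E.
Proof.
move=> t01 p0 q0 l01 pA qB.
have := convexU p0 q0 t01 t01 l01 pA qB.
by have -> : (1 - l) * t + l * t = t by ring.
Qed.

(* The segment from (s0, t h) to (s1, 1 - (1 - t) h) passes through
   ((1 - t) s0 + t s1, t) for every h. *)
Lemma geodesic_interpolation t s0 s1 (a0 a1 : R) : 0 < t < 1 ->
  (forall j, s0 j < 0) -> (forall j, s1 j < 0) ->
  (u0 (rexp s0) < a0%:E)%E -> (u1 (rexp s1) < a1%:E)%E ->
  (u t (rexp (fun j => (1 - t) * s0 j + t * s1 j)%R) <= ((1 - t) * a0 + t * a1)%:E)%E.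
Proof.
move=> /[dup] t01 /andP[t0 t1] s00 s10 h0 h1.
have [[_ _ l0 l1] _] := gu.
have [e0 e00 he0] := adherent_below (le_lt_trans (l0 _ (rexp_polydisk s00)) h0).
have [e1 e10 he1] := adherent_below (le_lt_trans (l1 _ (rexp_polydisk s10)) h1).
have [h [h00 hl0 hl1 h1']] : exists h : R, [/\ 0 < h, h <= e0, h <= e1 & h <= 1].
  exists (Num.min (Num.min e0 e1) 1).
  by split; rewrite ?lt_min ?e00 ?e10 ?ge_min ?lexx ?orbT//=.
have ta : 0 < t * h < 1 by apply/andP; split; nra.
have tb : 0 < 1 - (1 - t) * h < 1 by apply/andP; split; nra.
have ua : (u (t * h)%R (rexp s0) < a0%:E)%E.
  by apply: he0 => //; rewrite subr0 gtr0_norm; nra.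
have ub : (u (1 - (1 - t) * h)%R (rexp s1) < a1%:E)%E.
  apply: he1 => //; have -> : 1 - (1 - t) * h - 1 = - ((1 - t) * h) by ring.
  by rewrite normrN gtr0_norm; nra.
have := convexU s00 s10 ta tb t01 ua ub.
by have -> : (1 - t) * (t * h) + t * (1 - (1 - t) * h) = t by ring.
Qed.

Lemma geodesic_support t s : 0 < t < 1 -> (forall j, s j < 0) ->
  (-oo < u t (rexp s))%E ->
  exists2 c : R, u t (rexp s) = c%:E & exists y : 'I_n -> R,
    forall x, (forall j, x j < 0) -> forall b : R, (u t (rexp x) < b%:E)%E ->
      c + \sum_j (x j - s j) * y j <= b.
Proof.
move=> t01 s0 us.
have [[_ neg _ _] _] := gu.
have u_le0 x : (forall j, x j < 0) -> (u t (rexp x) <= 0)%E.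
  move=> x0; have := neg _ (explog_dom (point_dom x0 t01)).
  by rewrite /= cabs_expR expRK.
pose Om : set ('I_n -> R) := [set x | forall j, x j < 0].
have cvxO p q (l : R) : Om p -> Om q -> 0 <= l <= 1 -> Om (fun j => (1 - l) * p j + l * q j).
  by move=> p0 q0 l01 j; exact: convex_comb_lt.
have opn p : Om p -> exists2 r : R, 0 < r & forall x, (forall j, `|x j - p j| < r) -> Om x.
  move=> p0; exists (\big[Num.min/1]_j (- p j)).
    by apply: lt_bigmin => // j _; rewrite oppr_gt0.
  move=> x hx j; have : \big[Num.min/1]_j (- p j) <= - p j by exact: bigmin_le_cond.
  by have := hx j; rewrite ltr_norml => /andP[_ ]; lra.
(* A value -oo at [x] would propagate to [s]: prolong the segment from [x] slightly beyond [s],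
   where [u t <= 0], and let the bound at [x] go to -oo. *)
have finU x : Om x -> (-oo < u t (rexp x))%E.
  move=> x0; rewrite ltNye; apply/negP => /eqP ux.
  have [r r0 hr] := opn s s0.
  pose D := 1 + \sum_j `|s j - x j|.
  have S0 : 0 <= \sum_j `|s j - x j| by apply: sumr_ge0.
  have D0 : 0 < D by rewrite ltr_pwDl.
  pose h := r / 2 / D; have h0 : 0 < h by rewrite divr_gt0// divr_gt0.
  have Oz : Om (fun j => s j + h * (s j - x j)).
    apply: hr => j; rewrite addrC addKr normrM (gtr0_norm h0).
    have sD : `|s j - x j| <= D.
      rewrite /D (bigD1 j)//= addrCA lerDl addr_ge0//.
      by apply: sumr_ge0.
    apply: (@le_lt_trans _ _ (h * D)); first by rewrite ler_pM2l.
    by rewrite /h divfK ?gt_eqF//; lra.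
  pose l := (1 + h)^-1.
  have hp1 : 0 < 1 + h by lra.
  have l01 : 0 < l < 1.
    by rewrite invr_gt0 hp1/= invf_lt1//; lra.
  have lh : l * (1 + h) = 1 by rewrite mulVf// gt_eqF.
  have sE : s = (fun j => (1 - l) * x j + l * (s j + h * (s j - x j))).
    apply/funext => j.
    transitivity ((1 - l * (1 + h)) * x j + l * (1 + h) * s j); last by ring.
    by rewrite lh; ring.
  have uz1 : (u t (rexp (fun j => s j + h * (s j - x j))%R) < 1%:E)%E.
    by apply: (le_lt_trans (u_le0 _ Oz)); rewrite lte_fin.
  have := u_le0 _ s0; move: us; case us : (u t (rexp s)) => [c| |]// _ _.
  have l1 : 0 < 1 - l by case/andP: l01 => _; lra.
  (* The bound at [x] is chosen so that the convex combination with the bound 1 at the far end is c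
     - 1. *)
  have := @geodesic_convex t x _ l ((c - l - 1) / (1 - l)) 1 t01 x0 Oz l01.
  rewrite ux ltNyr -sE us lee_fin => /(_ isT uz1).
  by rewrite [(1 - l) * _]mulrC divfK ?gt_eqF//; lra.
pose f x := fine (u t (rexp x)).
have fE x : Om x -> u t (rexp x) = (f x)%:E.
  move=> x0; rewrite /f fineK// fin_numE gt_eqF ?finU//=.
  by rewrite lt_eqF// (le_lt_trans (u_le0 _ x0))// ltry.
have cvxf p q (l : R) : Om p -> Om q -> 0 < l < 1 ->
    f (fun j => (1 - l) * p j + l * q j) <= (1 - l) * f p + l * f q.
  move=> p0 q0 l01; apply/ler_addgt0Pr => e e0.
  have : (u t (rexp (fun j => (1 - l) * p j + l * q j)%R) <=
    ((1 - l) * (f p + e) + l * (f q + e))%:E)%E.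
    by apply: geodesic_convex => //; rewrite fE// lte_fin ltrDl.
  rewrite fE; last by apply: cvxO => //; case/andP: l01 => ? ?; rewrite !ltW.
  rewrite lee_fin => /le_trans; apply.
  by rewrite le_eqVlt; apply/orP; left; apply/eqP; ring.
have [y hy] := supporting_hyperplane cvxO opn cvxf s0.
exists (f s); first exact: fE.
exists y => x x0 b; rewrite fE// lte_fin => /ltW; apply: le_trans.
exact: hy.
Qed.

End Interpolation.

(** * Legendre transforms of convex images *)

Lemma convex_imageE (R : realType) (n : nat) (u : 'rV[Cx R]_n -> \bar R) (s : 'rV[R]_n) :
  (forall j, s ord0 j < 0) -> convex_image u s = u (rexp (fun j => s ord0 j)).
Proof. by move=> s0; rewrite /convex_image ifT// inE. Qed.

Lemma legendre_convex_imageP (R : realType) (n : nat) (u : 'rV[Cx R]_n -> \bar R)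
    (y : 'rV[R]_n) (b : \bar R) :
  (forall s : 'I_n -> R, (forall j, s j < 0) ->
    ((\sum_j s j * y ord0 j)%:E - u (rexp s) <= b)%E) ->
  (legendre (convex_image u) y <= b)%E.
Proof.
move=> h; apply: ge_ereal_sup => _ [x _ <-].
rewrite /convex_image; case: ifPn => [|_]; last by rewrite /= leNye.
by rewrite inE => x0; exact: (h (fun j => x ord0 j)).
Qed.

Lemma le_legendre_convex_image (R : realType) (n : nat) (u : 'rV[Cx R]_n -> \bar R)
    (y : 'rV[R]_n) (s : 'I_n -> R) : (forall j, s j < 0) ->
  ((\sum_j s j * y ord0 j)%:E - u (rexp s) <= legendre (convex_image u) y)%E.
Proof.
move=> s0; apply: ereal_sup_ubound; exists (\row_j s j) => //.
rewrite convex_imageE; last by move=> j; rewrite mxE.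
congr (_%:E - u _)%E; first by apply: eq_bigr => j _; rewrite mxE.
by apply/rowP => j; rewrite !mxE.
Qed.

(** Excludes indeterminate sums in (1 - t) L[u0] + t L[u1]: only real values and +oo can occur. *)
Lemma legendre_gtNy (R : realType) (n : nat) (u : 'rV[Cx R]_n -> \bar R) (y : 'rV[R]_n) :
  (forall z, polydisk R n z -> (u z < +oo)%E) ->
  (-oo < legendre (convex_image u) y)%E.
Proof.
move=> fin; have s0 (j : 'I_n) : -1 < 0 :> R by rewrite oppr_lt0.
apply: lt_le_trans (le_legendre_convex_image u y s0).
by have := fin _ (rexp_polydisk s0); case: (u _) => // b _; rewrite -EFinB ltNyr.
Qed.

Lemma legendre_bound (R : realType) (n : nat) (u : 'rV[Cx R]_n -> \bar R) (y : 'rV[R]_n)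
    (A : R) :
  (forall z, polydisk R n z -> (u z < +oo)%E) ->
  legendre (convex_image u) y = A%:E ->
  forall s : 'I_n -> R, (forall j, s j < 0) ->
    ((\sum_j s j * y ord0 j)%:E <= A%:E + u (rexp s))%E.
Proof.
move=> fin uA s s0; have := le_legendre_convex_image u y s0; rewrite uA.
have := fin _ (rexp_polydisk s0); case: (u (rexp s)) => // b _.
by rewrite -EFinB -EFinD !lee_fin lerBlDr.
Qed.

Lemma lee_sub_above (R : realType) (x : \bar R) (a b : R) :
  (forall c : R, (x < c%:E)%E -> a - c <= b) -> (a%:E - x <= b%:E)%E.
Proof.
move=> h; have : ((a - b)%:E <= x)%E.
  apply: contraTT isT; rewrite -ltNge => /lte_between[c xc cb].
  by have := h c xc; lra.
case: x h => [x| |]// h; last by rewrite leNye.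
by rewrite -EFinB !lee_fin lerBlDr lerBlDl addrC.
Qed.

Lemma legendre_mix_le_geodesic (R : realType) (n : nat) (u0 u1 : 'rV[Cx R]_n -> \bar R)
    (u : R -> 'rV[Cx R]_n -> \bar R) (t : R) (s : 'rV[R]_n) : (0 < n)%N ->
  plurisubharmonic (polydisk R n) u0 -> plurisubharmonic (polydisk R n) u1 ->
  toric u0 -> toric u1 ->
  zero_boundary_values u0 -> zero_boundary_values u1 ->
  geodesic u0 u1 u -> 0 < t < 1 -> Rneg R n s ->
  (legendre (fun y => (1 - t)%:E * legendre (convex_image u0) y
                     + t%:E * legendre (convex_image u1) y)%E s
   <= convex_image (u t) s)%E.
Proof.
move=> hn [fin0 usc0 _] [fin1 usc1 _] toric0 toric1 bdry0 bdry1 hu ht hs.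
have [t0 t1] := andP ht; have t1' : 0 < 1 - t by rewrite subr_gt0.
pose sg j := s ord0 j.
have sg0 j : sg j < 0 := hs j.
rewrite (convex_imageE _ hs) -/sg.
apply: ge_ereal_sup => _ [y _ <-].
have := legendre_gtNy y fin0; have := legendre_gtNy y fin1.
case L0 : (legendre (convex_image u0) y) => [A| |]//;
  case L1 : (legendre (convex_image u1) y) => [B| |]// _ _; last 3 first.
(* If either transform is +oo at [y], the corresponding term of the outer supremum is -oo. *)
- by rewrite gt0_muley ?lte_fin// -EFinM addey//= leNye.
- by rewrite gt0_muley ?lte_fin// -EFinM addye//= leNye.
- by rewrite !gt0_muley ?lte_fin//= leNye.
have hA := legendre_bound fin0 L0; have hB := legendre_bound fin1 L1.
have y0 := legendre_point_ge0 fin0 usc0 hA.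
have A0 := legendre_value_ge0 hn bdry0 hA; have B0 := legendre_value_ge0 hn bdry1 hB.
have [_ umax] := hu.
have sub := candidate_subgeodesic usc0 usc1 toric0 toric1 y0 A0 B0 hA hB.
apply: (le_trans _ (umax _ sub t _ ht (rexp_polydisk sg0))).
apply: (le_trans _ (candidate_explog A B y0 t s)).
exact: lexx.
Qed.

Lemma geodesic_le_legendre_mix (R : realType) (n : nat) (u0 u1 : 'rV[Cx R]_n -> \bar R)
    (u : R -> 'rV[Cx R]_n -> \bar R) (t : R) (s : 'rV[R]_n) :
  plurisubharmonic (polydisk R n) u0 -> plurisubharmonic (polydisk R n) u1 ->
  toric u0 -> toric u1 ->
  geodesic u0 u1 u -> 0 < t < 1 -> Rneg R n s ->
  (convex_image (u t) s <=
   legendre (fun y => (1 - t)%:E * legendre (convex_image u0) y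
                     + t%:E * legendre (convex_image u1) y)%E s)%E.
Proof.
move=> [fin0 usc0 _] [fin1 usc1 _] toric0 toric1 hu ht hs.
have [t0 t1] := andP ht; have t1' : 0 < 1 - t by rewrite subr_gt0.
pose sg j := s ord0 j.
have sg0 j : sg j < 0 := hs j.
rewrite (convex_imageE _ hs) -/sg.
have [us|] := ltP -oo%E (u t (rexp sg)); last by rewrite leeNy_eq => /eqP ->; exact: leNye.
have [c uc [y hy]] := geodesic_support toric0 toric1 hu ht sg0 us.
rewrite uc.
pose Y : 'rV[R]_n := \row_j y j.
pose ip (p : 'I_n -> R) := \sum_j p j * y j.
have ipY p : \sum_j p j * Y ord0 j = ip p by apply: eq_bigr => j _; rewrite mxE.
(* The support inequality at the interpolated point, separated into a part in [s0] and a part in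
   [s1] that vary independently. *)
have key (s0 s1 : 'I_n -> R) (a0 a1 : R) : (forall j, s0 j < 0) -> (forall j, s1 j < 0) ->
    (u0 (rexp s0) < a0%:E)%E -> (u1 (rexp s1) < a1%:E)%E ->
    (1 - t) * (ip s0 - a0) + t * (ip s1 - a1) <= ip sg - c.
  move=> s00 s10 h0 h1.
  have := geodesic_interpolation toric0 toric1 hu ht s00 s10 h0 h1.
  set x := fun j => _ => ux.
  have x0 j : x j < 0 by apply: convex_comb_lt => //; rewrite !ltW.
  have -> : (1 - t) * (ip s0 - a0) + t * (ip s1 - a1) = ip x - ((1 - t) * a0 + t * a1).
    transitivity ((1 - t) * ip s0 + t * ip s1 - ((1 - t) * a0 + t * a1)); first by ring.
    congr (_ - _); rewrite /ip !big_distrr/= -big_split/=.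
    by apply: eq_bigr => j _; rewrite /x; ring.
  have : c + (ip x - ip sg) <= (1 - t) * a0 + t * a1.
    have -> : ip x - ip sg = \sum_j (x j - sg j) * y j.
      by rewrite /ip -sumrB; apply: eq_bigr => j _; ring.
    apply/ler_addgt0Pr => e e0; apply: hy => //.
    by apply: (le_lt_trans ux); rewrite lte_fin ltrDl.
  by clear; lra.
pose m (j : 'I_n) : R := -1.
have m0 j : m j < 0 by rewrite oppr_lt0.
have fin_above (x : \bar R) : (x < +oo)%E -> exists a : R, (x < a%:E)%E.
  case: x => [a _|//|_]; first by exists (a + 1); rewrite lte_fin ltrDl.
  by exists 0; exact: ltNyr.
have [b1 hb1] := fin_above _ (fin1 _ (rexp_polydisk m0)).
(* Fixing the second point at [m] gives only a crude bound, enough to make the first transform a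
   real number [A]. The sharp estimate then comes from taking the supremum over [s0] for each
   [s1]. *)
have L0 : (legendre (convex_image u0) Y <= ((ip sg - c - t * (ip m - b1)) / (1 - t))%:E)%E.
  apply: legendre_convex_imageP => s0 s00; rewrite ipY; apply: lee_sub_above => a h0.
  rewrite ler_pdivlMr// mulrC.
  by have := key _ _ _ _ s00 m0 h0 hb1; clear; lra.
have := legendre_gtNy Y fin0; case E0 : (legendre (convex_image u0) Y) L0 => [A| |]// _ _.
have L1 : (legendre (convex_image u1) Y <= ((ip sg - c - (1 - t) * A) / t)%:E)%E.
  apply: legendre_convex_imageP => s1 s10; rewrite ipY; apply: lee_sub_above => a h1.
  have : A <= (ip sg - c - t * (ip s1 - a)) / (1 - t).
    rewrite -lee_fin -E0; apply: legendre_convex_imageP => s0 s00.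
    rewrite ipY; apply: lee_sub_above => a0 h0.
    rewrite ler_pdivlMr// mulrC.
    by have := key _ _ _ _ s00 s10 h0 h1; clear; lra.
  by rewrite !ler_pdivlMr//; clear; lra.
have := legendre_gtNy Y fin1; case E1 : (legendre (convex_image u1) Y) L1 => [B| |]// + _.
rewrite lee_fin ler_pdivlMr// mulrC => hAB.
(* The slope of the supporting hyperplane is the test point in the outer supremum. *)
apply: le_trans (ereal_sup_ubound _); last by exists Y.
rewrite /= E0 E1 lee_fin.
have -> : dotp Y s = ip sg by apply: eq_bigr => j _; rewrite mxE mulrC.
by move: hAB; clear; lra.
Qed.

Local Open Scope ereal_scope.

Theorem theorem5p1 (R : realType) (n : nat) (hn : (0 < n)%N)
    (u0 u1 : 'rV[Cx R]_n -> \bar R)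
    (psh0 : plurisubharmonic (polydisk R n) u0)
    (psh1 : plurisubharmonic (polydisk R n) u1)
    (toric0 : toric u0) (toric1 : toric u1)
    (bdry0 : zero_boundary_values u0) (bdry1 : zero_boundary_values u1)
    (u : R -> 'rV[Cx R]_n -> \bar R) (hu : geodesic u0 u1 u)
    (t : R) (ht : (0 < t < 1)%R) (s : 'rV[R]_n) (hs : Rneg R n s) :
  convex_image (u t) s =
  legendre (fun y => (1 - t)%:E * legendre (convex_image u0) y
                     + t%:E * legendre (convex_image u1) y) s.
Proof.
apply/eqP; rewrite eq_le geodesic_le_legendre_mix//=.
exact: legendre_mix_le_geodesic.
Qed.
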